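(* Let $m,n$ be positive integers. The multigraph $\mathcal{M}_{m,n}$ admits a nullhomotopic knight's tour if and only if none of the following hold: (i) $m$ and $n$ are both odd and at least one of $m,n$ is greater than $1$; (ii) $m=1$ and $n>1$; (iii) $m=2$; (iv) $m=3$ and $n=4$; (v) $m=4$ and $n$ is odd.
   Context: For a positive integer $m$, let $\mathcal{S}_m$ be the graph with vertex set $\{(a,b)\in\mathbb{Z}^2 : 0\le a<m\}$, where $(a,b)$ and $(a',b')$ are joined by an edge iff $\{|a-a'|,|b-b'|\}=\{1,2\}$ (knight moves on an infinite strip of width $m$). For a positive integer $n$, the map $\sigma(a,b)=(m-1-a,\,b+n)$ is a graph automorphism of $\mathcal{S}_m$ generating a free action of $\mathbb{Z}$; the knight's multigraph of the $m\times n$ Möbius strip board is the quotient $\mathcal{M}_{m,n}=\mathcal{S}_m/\langle\sigma\rangle$, whose vertices are the orbits of vertices (represented by $(a,b)$ with $0\le a<m$, $0\le b<n$) and whose edges are the orbits of edges (so $\mathcal{M}_{m,n}$ may have multiple edges or loops for small $m,n$). This models a knight on an $m\times n$ board whose top and bottom edges are identified with a half-twist, and the quotient map $\phi_M:\mathcal{S}_m\to\mathcal{M}_{m,n}$ is a covering map. A knight's tour is a closed walk (a sequence of vertices and edges) that visits every vertex exactly once apart from the start vertex being repeated at the end (a Hamiltonian cycle; when there is a single vertex, the trivial walk of length $0$ counts). Regard a tour as a closed walk starting and ending at the vertex $(0,0)$; it lifts uniquely along $\phi_M$ to a walk in $\mathcal{S}_m$ starting at $(0,0)$. The tour is nullhomotopic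 if this lift ends at $(0,0)$ (equivalently, the corresponding closed curve on the Möbius strip is contractible). *)

(* Defs.v *)
From Stdlib Require Import ZArith List.
Import ListNotations.
Open Scope Z_scope.

Definition cell : Type := (Z * Z)%type.

Definition in_strip (m : Z) (p : cell) : Prop := 0 <= fst p < m.

Definition knight_move (p q : cell) : Prop :=
  (Z.abs (fst p - fst q) = 1 /\ Z.abs (snd p - snd q) = 2) \/
  (Z.abs (fst p - fst q) = 2 /\ Z.abs (snd p - snd q) = 1).

Definition S_adj (m : Z) (p q : cell) : Prop :=
  in_strip m p /\ in_strip m q /\ knight_move p q.

Definition sigma (m n : Z) (p : cell) : cell := (m - 1 - fst p, snd p + n).
Definition sigma_inv (m n : Z) (p : cell) : cell := (m - 1 - fst p, snd p - n).

Definition sigma_pow (m n : Z) (k : Z) (p : cell) : cell :=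
  match k with
  | Z0 => p
  | Zpos q => Pos.iter (sigma m n) p q
  | Zneg q => Pos.iter (sigma_inv m n) p q
  end.

(** p and q lie in the same <sigma>-orbit, i.e. represent the same vertex of M_{m,n}. *)
Definition same_orbit (m n : Z) (p q : cell) : Prop :=
  exists k : Z, sigma_pow m n k p = q.

(** The (undirected) edges {p,q} and {p',q'} of S_m lie in the same orbit,
    i.e. represent the same edge of the multigraph M_{m,n}. *)
Definition same_edge_orbit (m n : Z) (p q p' q' : cell) : Prop :=
  exists k : Z,
    (sigma_pow m n k p = p' /\ sigma_pow m n k q = q') \/
    (sigma_pow m n k p = q' /\ sigma_pow m n k q = p').

Definition S_walk (m : Z) (w : list cell) : Prop :=
  w <> [] /\
  forall i : nat, (S i < length w)%nat ->
    S_adj m (nth i w (0,0)) (nth (S i) w (0,0)).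

(** [tour_lift m n w]: w = [v_0; ...; v_k] is the (unique) lift, starting at
    (0,0), of a knight's tour of M_{m,n} regarded as a closed walk based at the
    vertex (0,0).  Namely: the projection of w is a closed walk of M_{m,n}
    (v_k in the orbit of v_0 = (0,0)); the vertices v_0,...,v_{k-1} project to
    pairwise distinct vertices of M_{m,n}; the edges (v_i,v_{i+1}), i<k,
    project to pairwise distinct edges of M_{m,n} (a cycle does not reuse an
    edge; this only matters for k = 2); and every vertex of M_{m,n}
    (represented by (a,b), 0<=a<m, 0<=b<n) is visited.  The trivial walk
    w = [(0,0)] (k = 0) is allowed. *)
Definition tour_lift (m n : Z) (w : list cell) : Prop :=
  S_walk m w /\
  nth 0 w (0,0) = (0,0) /\
  same_orbit m n (last w (0,0)) (0,0) /\
  (forall i j : nat, (i < j)%nat -> (S j < length w)%nat ->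
     ~ same_orbit m n (nth i w (0,0)) (nth j w (0,0))) /\
  (forall i j : nat, (i < j)%nat -> (S j < length w)%nat ->
     ~ same_edge_orbit m n (nth i w (0,0)) (nth (S i) w (0,0))
                           (nth j w (0,0)) (nth (S j) w (0,0))) /\
  (forall a b : Z, 0 <= a < m -> 0 <= b < n ->
     exists i : nat, (i < length w)%nat /\ same_orbit m n (nth i w (0,0)) (a,b)).

Definition has_nullhomotopic_tour (m n : Z) : Prop :=
  exists w : list cell, tour_lift m n w /\ last w (0,0) = (0,0).

(* Main.v *)
(** The nullhomotopic tours are the cycles in the strip that meet every orbit of [sigma]
    exactly once. Two cycles with parallel edges can be merged into one, and an edge of a
    cycle can be replaced by a path through new cells; everything grows from finitely many
    base tours, found by computer search, in four ways. For [m, n >= 5] ordinary tours of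
    rectangles are glued in both directions. For [n <= 4] the board is widened by an
    annulus of width 3 around it, whose cells are represented by the columns [0, 1, 2]
    over [2 n] values of [b]. For [m = 3] rectangles are lengthened by four. For [m = 4]
    the tour uses half of the cells of a board twice as long, which is again lengthened
    by four. Conversely, the excluded boards are ruled out by parity ([m], [n] odd), by
    acyclicity ([m <= 2]), by exhaustive search ([m = 3], [n = 4]), and by the alternation
    of border and inner cells ([m = 4]). *)

Require Import Defs.
From Stdlib Require Import ZArith List Lia Bool Permutation.
Import ListNotations.
Open Scope Z_scope.

(** * Paths and cycles of knight moves *)

(** What shapes the case split is that the lift often has to leave the [m] by [n] rectangle. By the
    classical theorem on closed knight's tours of rectangles there is none with a side equal to 2 or
    4, and none of size 3 by 4, 3 by 6 or 3 by 8. Where both sides are at least 5, or [m = 3] and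
    [n >= 10], a tour of the rectangle is its own lift and the twist plays no part; the other sizes
    use tours spread over several copies of the rectangle. Growth by induction rests on two points.
    Meeting every orbit once depends only on the cells and not on their order, so it survives any
    rerouting and can be handled up to [Permutation]. And each family of tours carries links at
    prescribed places: the next piece is attached at such a link, and the enlarged tour again offers
    links at the corresponding places. Thus infinitely many sizes reduce to finitely many boolean
    checks on explicit lists. *)

Fixpoint steps {A : Type} (l : list A) : list (A * A) :=
  match l with
  | x :: ((y :: _) as t) => (x, y) :: steps t
  | _ => []
  end.

Definition cyclic_steps {A : Type} (l : list A) : list (A * A) :=
  steps (l ++ firstn 1 l).

Definition links {A : Type} (s : list (A * A)) (x y : A) : Prop :=
  In (x, y) s \/ In (y, x) s.

Definition path (l : list cell) (p q : cell) : Prop :=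
  (forall x y, In (x, y) (steps l) -> knight_move x y) /\
  (exists t, l = p :: t) /\ (exists t, l = t ++ [q]).

(** Closedness is all that is asked: repeated cells are excluded separately, by [transversal] or
    [enumerates]. Two adjacent cells form a [cycle] that runs along one edge twice, so distinctness
    of edges has to come from a bound on the length. *)
Definition cycle (l : list cell) : Prop :=
  forall x y, In (x, y) (cyclic_steps l) -> knight_move x y.

Lemma knight_move_sym p q : knight_move p q -> knight_move q p.
Proof. unfold knight_move; lia. Qed.

Lemma steps_app {A : Type} (l1 l2 : list A) x :
  steps (l1 ++ x :: l2) = steps (l1 ++ [x]) ++ steps (x :: l2).
Proof.
  induction l1 as [|y [|z l1] IH]; [reflexivity..|].
  change (steps ((y :: z :: l1) ++ x :: l2))
    with ((y, z) :: steps ((z :: l1) ++ x :: l2)).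
  rewrite IH; reflexivity.
Qed.

Lemma in_steps_split {A : Type} (l : list A) x y :
  In (x, y) (steps l) -> exists l1 l2, l = l1 ++ x :: y :: l2.
Proof.
  induction l as [|a [|b l] IH]; simpl; [tauto..|].
  intros [E | H].
  - injection E as -> ->; exists [], l; reflexivity.
  - destruct (IH H) as (l1 & l2 & E); exists (a :: l1), l2.
    simpl; rewrite E; reflexivity.
Qed.

Lemma steps_middle {A : Type} (l1 l2 : list A) x y :
  steps (l1 ++ x :: y :: l2) = steps (l1 ++ [x]) ++ (x, y) :: steps (y :: l2).
Proof. rewrite steps_app; reflexivity. Qed.

Lemma in_steps_rev {A : Type} (l : list A) x y :
  In (x, y) (steps l) -> In (y, x) (steps (rev l)).
Proof.
  intros H; apply in_steps_split in H as (l1 & l2 & ->).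
  rewrite rev_app_distr; simpl; rewrite <- !app_assoc; simpl.
  rewrite steps_middle; apply in_or_app; right; left; reflexivity.
Qed.

Lemma steps_map {A B : Type} (f : A -> B) l :
  steps (map f l) = map (fun e => (f (fst e), f (snd e))) (steps l).
Proof.
  induction l as [|x [|y l] IH]; [reflexivity..|].
  simpl in *; rewrite IH; reflexivity.
Qed.

Lemma cyclic_steps_map {A B : Type} (f : A -> B) l :
  cyclic_steps (map f l) = map (fun e => (f (fst e), f (snd e))) (cyclic_steps l).
Proof.
  unfold cyclic_steps; rewrite <- steps_map, map_app, firstn_map; reflexivity.
Qed.

Lemma links_map {A B : Type} (f : A -> B) l x y :
  links (cyclic_steps l) x y -> links (cyclic_steps (map f l)) (f x) (f y).
Proof.
  rewrite cyclic_steps_map; intros [H | H]; [left | right];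
    exact (in_map (fun e => (f (fst e), f (snd e))) _ _ H).
Qed.

Lemma cycle_map f l :
  (forall x y, knight_move x y -> knight_move (f x) (f y)) ->
  cycle l -> cycle (map f l).
Proof.
  intros Hf Hl x y; rewrite cyclic_steps_map; intros H.
  apply in_map_iff in H as ([u v] & E & H); injection E as <- <-; auto.
Qed.

Lemma path_rev l p q : path l p q -> path (rev l) q p.
Proof.
  intros (W & (t & E) & (t' & E')); repeat split.
  - intros x y H; apply in_steps_rev in H; rewrite rev_involutive in H.
    apply knight_move_sym; auto.
  - exists (rev t'); rewrite E', rev_app_distr; reflexivity.
  - exists (rev t); rewrite E; reflexivity.
Qed.

Lemma links_steps_rev {A : Type} (l : list A) x y :
  links (steps l) x y -> links (steps (rev l)) x y.
Proof. intros [H | H]; [right | left]; apply in_steps_rev; exact H. Qed.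

(** Cutting the cycle at the oriented step from [p] to [q] and reading on from [q] yields a path
    that ends in [p] and loses only that step. *)
Lemma rotate_cycle {A : Type} (w : list A) p q :
  In (p, q) (cyclic_steps w) ->
  exists l, Permutation w l /\ (exists t, l = q :: t) /\ (exists t, l = t ++ [p]) /\
    (forall x y, In (x, y) (steps l) -> In (x, y) (cyclic_steps w)) /\
    (forall x y, In (x, y) (cyclic_steps w) ->
                 (x, y) = (p, q) \/ In (x, y) (steps l)).
Proof.
  destruct w as [|h t]; [intros []|].
  unfold cyclic_steps; simpl firstn; intros H.
  apply in_steps_split in H as (l1 & l2 & E).
  (* If nothing follows [q], the cut is at the closing step and [q] is the head of [w]; otherwise
     the last entry [z] is the repeated head. *)
  destruct l2 as [|z l2 _] using rev_ind.
  - assert (E' : (h :: t) ++ [h] = (l1 ++ [p]) ++ [q])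
      by (rewrite E, <- app_assoc; reflexivity).
    apply app_inj_tail in E' as [E' <-].
    exists (h :: t); split; [reflexivity|].
    split; [exists t; reflexivity|]. split; [exists l1; exact E'|].
    rewrite E', <- app_assoc; simpl; rewrite steps_middle.
    split; intros x y H; [apply in_or_app; tauto|].
    apply in_app_or in H as [H | [H | []]]; auto.
  - assert (E' : (h :: t) ++ [h] = (l1 ++ p :: q :: l2) ++ [z])
      by (rewrite E, <- app_assoc; reflexivity).
    apply app_inj_tail in E' as [E' <-].
    exists ((q :: l2) ++ (l1 ++ [p])); split.
    { rewrite E'. change (p :: q :: l2) with ([p] ++ q :: l2).
      rewrite app_assoc; apply Permutation_app_comm. }
    split; [eexists; reflexivity|].
    split; [exists ((q :: l2) ++ l1); rewrite <- app_assoc; reflexivity|].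
    rewrite E', <- app_assoc; cbn [app].
    rewrite steps_middle.
    assert (exists u, l1 ++ [p] = h :: u) as (u & Eu)
      by (destruct l1; injection E' as -> _; eexists; reflexivity).
    rewrite Eu.
    change (q :: l2 ++ h :: u) with ((q :: l2) ++ h :: u).
    rewrite (steps_app (q :: l2) u h).
    change (q :: l2 ++ [h]) with ((q :: l2) ++ [h]).
    split; intros x y H; rewrite !in_app_iff in *; simpl in *; intuition auto.
Qed.

Lemma open_cycle w p q :
  cycle w -> links (cyclic_steps w) p q ->
  exists l, Permutation w l /\ path l p q /\
    forall x y, links (cyclic_steps w) x y ->
      (x, y) = (p, q) \/ (x, y) = (q, p) \/ links (steps l) x y.
Proof.
  assert (R : forall p q, cycle w -> In (p, q) (cyclic_steps w) ->
    exists l, Permutation w l /\ path l q p /\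
      forall x y, links (cyclic_steps w) x y ->
        (x, y) = (p, q) \/ (x, y) = (q, p) \/ links (steps l) x y).
  { clear p q; intros p q C H.
    destruct (rotate_cycle _ _ _ H) as (l & P & B & E & S1 & S2).
    exists l; split; [exact P|]. split; [repeat split; auto|].
    intros x y [Hxy | Hxy]; apply S2 in Hxy as [Hxy | Hxy].
    - auto.
    - right; right; left; exact Hxy.
    - injection Hxy as -> ->; auto.
    - right; right; right; exact Hxy. }
  intros C [H | H]; destruct (R _ _ C H) as (l & P & Hl & S).
  - exists (rev l); split; [rewrite P; apply Permutation_rev|].
    split; [apply path_rev; exact Hl|].
    intros x y Hxy; destruct (S x y Hxy) as [|[|]]; auto using links_steps_rev.
  - exists l; split; [exact P|]. split; [exact Hl|].
    intros x y Hxy; destruct (S x y Hxy) as [|[|]]; auto.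
Qed.

Lemma join_paths l1 l2 p q r s :
  path l1 p q -> path l2 r s -> knight_move q r -> knight_move s p ->
  cycle (l1 ++ l2) /\
  (forall x y, links (steps l1) x y -> links (cyclic_steps (l1 ++ l2)) x y) /\
  (forall x y, links (steps l2) x y -> links (cyclic_steps (l1 ++ l2)) x y).
Proof.
  intros (W1 & (t1 & B1) & (u1 & E1)) (W2 & (t2 & B2) & (u2 & E2)) K1 K2.
  assert (E : cyclic_steps (l1 ++ l2) =
              steps l1 ++ (q, r) :: steps l2 ++ [(s, p)]).
  { assert (E3 : steps (l2 ++ [p]) = steps l2 ++ [(s, p)])
      by (rewrite E2, <- app_assoc; cbn [app]; rewrite steps_middle; reflexivity).
    rewrite <- E3; clear E3; subst l2.
    assert (F : firstn 1 (l1 ++ r :: t2) = [p]) by (rewrite B1; reflexivity).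
    unfold cyclic_steps; rewrite F, E1, <- !app_assoc; cbn [app].
    rewrite steps_middle; reflexivity. }
  unfold cycle, links; rewrite E; split; [|split].
  - intros x y H; rewrite !in_app_iff in H; simpl in H; rewrite in_app_iff in H.
    destruct H as [H | [H | [H | [H | []]]]]; auto; injection H as <- <-; auto.
  - intros x y; rewrite !in_app_iff; tauto.
  - intros x y; rewrite !in_app_iff; simpl; rewrite !in_app_iff; tauto.
Qed.

(** The edge between [p] and [q] is replaced by the detour [p], [r], ..., [s], [q]. All other links
    survive and those of the detour are gained, which is what lets a tour be extended again. *)
Lemma insert_path w l p q r s :
  cycle w -> links (cyclic_steps w) p q -> path l r s ->
  knight_move p r -> knight_move q s ->
  exists w', cycle w' /\ Permutation w' (w ++ l) /\
    (forall x y, links (cyclic_steps w) x y ->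
       (x, y) = (p, q) \/ (x, y) = (q, p) \/ links (cyclic_steps w') x y) /\
    (forall x y, links (steps l) x y -> links (cyclic_steps w') x y).
Proof.
  intros C H Hl Kp Kq.
  destruct (open_cycle _ _ _ C H) as (l1 & P & Hl1 & S).
  destruct (join_paths (rev l1) l q p r s) as (C' & S1 & S2);
    auto using path_rev, knight_move_sym.
  exists (rev l1 ++ l); split; [exact C'|]. split.
  { apply Permutation_app_tail; rewrite P; symmetry; apply Permutation_rev. }
  split; [|exact S2].
  intros x y Hxy; destruct (S x y Hxy) as [|[|]]; auto using links_steps_rev.
Qed.

(** The second cycle, opened at its link, is the detour inserted into the first one. *)
Lemma glue_cycles w1 w2 p q r s :
  cycle w1 -> cycle w2 ->
  links (cyclic_steps w1) p q -> links (cyclic_steps w2) r s ->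
  knight_move p r -> knight_move q s ->
  exists w, cycle w /\ Permutation w (w1 ++ w2) /\
    (forall x y, links (cyclic_steps w1) x y ->
       (x, y) = (p, q) \/ (x, y) = (q, p) \/ links (cyclic_steps w) x y) /\
    (forall x y, links (cyclic_steps w2) x y ->
       (x, y) = (r, s) \/ (x, y) = (s, r) \/ links (cyclic_steps w) x y).
Proof.
  intros C1 C2 H1 H2 Kp Kq.
  destruct (open_cycle _ _ _ C2 H2) as (l & P & Hl & S).
  destruct (insert_path _ _ _ _ _ _ C1 H1 Hl Kp Kq) as (w & C & P' & S1 & S2).
  exists w; split; [exact C|]. split; [rewrite P', P; reflexivity|].
  split; [exact S1|].
  intros x y Hxy; destruct (S x y Hxy) as [|[|]]; auto.
Qed.

(** * Orbits and transversals *)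

Definition slide (m n k : Z) (p : cell) : cell :=
  (if Z.even k then fst p else m - 1 - fst p, snd p + k * n).

(** The representative in the fundamental domain [0 <= b < n]: the parity of the quotient tells
    whether the cell has been reflected. It is a computable complete invariant of the orbit, so
    questions about orbits become equations. *)
Definition normal_form (m n : Z) (p : cell) : cell :=
  (if Z.even (snd p / n) then fst p else m - 1 - fst p, snd p mod n).

Lemma even_succ_negb k : Z.even (k + 1) = negb (Z.even k).
Proof. rewrite Z.even_add; destruct (Z.even k); reflexivity. Qed.

Lemma even_pred_negb k : Z.even (k - 1) = negb (Z.even k).
Proof. rewrite Z.even_sub; destruct (Z.even k); reflexivity. Qed.

Lemma sigma_pow_slide m n k p : sigma_pow m n k p = slide m n k p.
Proof.
  destruct p as [a b]; destruct k as [|k|k]; unfold slide; cbn [fst snd].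
  - simpl; f_equal; lia.
  - cbn [sigma_pow]; induction k as [|k IH] using Pos.peano_ind.
    + change (Z.even 1) with false; unfold sigma; cbn [Pos.iter fst snd].
      f_equal; lia.
    + rewrite Pos.iter_succ, IH, Pos2Z.inj_succ; unfold Z.succ, sigma; cbn [fst snd].
      rewrite even_succ_negb; destruct (Z.even (Zpos k)); simpl negb; cbv iota;
        f_equal; lia.
  - cbn [sigma_pow]; induction k as [|k IH] using Pos.peano_ind.
    + change (Z.even (-1)) with false; unfold sigma_inv; cbn [Pos.iter fst snd].
      f_equal; lia.
    + replace (Zneg (Pos.succ k)) with (Zneg k - 1) by lia.
      rewrite Pos.iter_succ, IH; unfold sigma_inv; cbn [fst snd].
      rewrite even_pred_negb; destruct (Z.even (Zneg k)); simpl negb; cbv iota;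
        f_equal; lia.
Qed.

Lemma same_orbit_slide m n p q :
  same_orbit m n p q <-> exists k, slide m n k p = q.
Proof.
  split; intros [k H]; exists k; [rewrite <- sigma_pow_slide | rewrite sigma_pow_slide];
    exact H.
Qed.

Lemma normal_form_slide m n k p :
  0 < n -> normal_form m n (slide m n k p) = normal_form m n p.
Proof.
  intros hn; destruct p as [a b]; unfold normal_form, slide; cbn [fst snd].
  rewrite Z.div_add, Z.mod_add, Z.even_add by lia.
  destruct (Z.even k), (Z.even (b / n)); simpl; f_equal; lia.
Qed.

Lemma same_orbit_normal_form m n p q :
  0 < n -> same_orbit m n p q <-> normal_form m n p = normal_form m n q.
Proof.
  intros hn; rewrite same_orbit_slide; split.
  - intros [k <-]; symmetry; apply normal_form_slide; exact hn.
  - destruct p as [a b], q as [c d]; unfold normal_form, slide; cbn [fst snd].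
    intros E; injection E as E1 E2.
    exists (d / n - b / n); rewrite Z.even_sub.
    pose proof (Z.div_mod b n) as Hb; pose proof (Z.div_mod d n) as Hd.
    f_equal; [|rewrite Z.mul_sub_distr_r; lia].
    destruct (Z.even (b / n)), (Z.even (d / n)); simpl; lia.
Qed.

Lemma normal_form_box m n p :
  0 < n -> in_strip m p ->
  0 <= fst (normal_form m n p) < m /\ 0 <= snd (normal_form m n p) < n.
Proof.
  intros hn; destruct p as [a b]; unfold normal_form, in_strip; cbn [fst snd].
  intros ha; pose proof (Z.mod_pos_bound b n hn).
  destruct (Z.even (b / n)); lia.
Qed.

Lemma normal_form_id m n a b : 0 <= b < n -> normal_form m n (a, b) = (a, b).
Proof.
  intros hb; unfold normal_form; cbn [fst snd].
  rewrite Z.div_small, Z.mod_small by lia; reflexivity.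
Qed.

Lemma in_strip_slide m n k p : in_strip m p -> in_strip m (slide m n k p).
Proof.
  destruct p as [a b]; unfold in_strip, slide; cbn [fst snd].
  destruct (Z.even k); lia.
Qed.

Lemma knight_move_slide m n k p q :
  knight_move p q -> knight_move (slide m n k p) (slide m n k q).
Proof.
  destruct p as [a b], q as [c d]; unfold knight_move, slide; cbn [fst snd].
  destruct (Z.even k); lia.
Qed.

(** [trans_inj] compares cells and cannot see a cell listed twice, hence the separate
    [trans_nodup]. *)
Record transversal (m n : Z) (l : list cell) : Prop := {
  trans_strip : forall x, In x l -> in_strip m x;
  trans_nodup : NoDup l;
  trans_inj : forall x y, In x l -> In y l -> same_orbit m n x y -> x = y;
  trans_cover : forall p, in_strip m p -> exists x, In x l /\ same_orbit m n x p }.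

Lemma transversal_perm m n l l' :
  Permutation l l' -> transversal m n l -> transversal m n l'.
Proof.
  intros P [S N I C]; split.
  - intros x H; apply S; rewrite P; exact H.
  - rewrite <- P; exact N.
  - intros x y Hx Hy; apply I; rewrite P; assumption.
  - intros p Hp; destruct (C p Hp) as (x & Hx & O); exists x; split;
      [rewrite <- P|]; assumption.
Qed.

Lemma transversal_slide m n k l :
  0 < n -> transversal m n l -> transversal m n (map (slide m n k) l).
Proof.
  intros hn [S N I C].
  assert (O : forall x y, same_orbit m n (slide m n k x) y <-> same_orbit m n x y)
    by (intros x y; rewrite !same_orbit_normal_form, normal_form_slide by lia; tauto).
  assert (O' : forall x y, same_orbit m n x (slide m n k y) <-> same_orbit m n x y)
    by (intros x y; rewrite !same_orbit_normal_form, normal_form_slide by lia; tauto).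
  split.
  - intros x H; apply in_map_iff in H as (y & <- & H); apply in_strip_slide; auto.
  - apply NoDup_map_NoDup_ForallPairs; [|exact N].
    intros x y Hx Hy E; apply I; auto.
    apply O'; rewrite <- E; apply O'; apply same_orbit_normal_form; auto.
  - intros x y Hx Hy H; apply in_map_iff in Hx as (x' & <- & Hx).
    apply in_map_iff in Hy as (y' & <- & Hy).
    f_equal; apply I; auto; apply O, O'; exact H.
  - intros p Hp; destruct (C p Hp) as (x & Hx & H).
    exists (slide m n k x); split; [apply in_map; exact Hx | apply O; exact H].
Qed.

(** The cells [(0, 0)], [(1, 0)] and [(2, 0)] lie in different orbits. Three cells are enough to
    rule out the degenerate cycle of length two. *)
Lemma transversal_length m n l :
  0 < n -> 3 <= m -> transversal m n l -> (3 <= length l)%nat.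
Proof.
  intros hn hm [_ _ _ C].
  assert (R : forall a, 0 <= a < m ->
            exists x, In x l /\ normal_form m n x = (a, 0)).
  { intros a Ha; destruct (C (a, 0) Ha) as (x & Hx & O); exists x; split; [exact Hx|].
    apply same_orbit_normal_form in O; [|exact hn].
    rewrite O; apply normal_form_id; lia. }
  destruct (R 0) as (x & Hx & Ex); [lia|].
  destruct (R 1) as (y & Hy & Ey); [lia|].
  destruct (R 2) as (z & Hz & Ez); [lia|].
  change 3%nat with (length [x; y; z]); apply NoDup_incl_length.
  - repeat constructor; simpl; intuition congruence.
  - intros u; simpl; intuition congruence.
Qed.

Lemma in_steps_nth {A : Type} (l : list A) d i :
  (S i < length l)%nat -> In (nth i l d, nth (S i) l d) (steps l).
Proof.
  revert i; induction l as [|x [|y l] IH]; intros i Hi; simpl in Hi; [lia..|].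
  destruct i as [|i]; [left; reflexivity|].
  right; apply (IH i); simpl; lia.
Qed.

Lemma cycle_from (l : list cell) x :
  cycle l -> In x l ->
  exists l', Permutation l l' /\ cycle l' /\ exists t, l' = x :: t.
Proof.
  intros C Hx; apply in_split in Hx as (l1 & l2 & ->).
  exists ((x :: l2) ++ l1); split; [apply Permutation_app_comm|].
  split; [|eexists; reflexivity].
  destruct l1 as [|h l1]; [rewrite app_nil_r; exact C|].
  intros y z H; apply C; revert H; unfold cyclic_steps; simpl firstn.
  cbn [app]; rewrite <- !app_assoc; cbn [app].
  change (x :: l2 ++ h :: l1 ++ [x]) with ((x :: l2) ++ h :: (l1 ++ [x])).
  change (h :: l1 ++ x :: l2 ++ [h]) with ((h :: l1) ++ x :: (l2 ++ [h])).
  rewrite (steps_app (x :: l2) (l1 ++ [x]) h), (steps_app (h :: l1) (l2 ++ [h]) x).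
  rewrite !in_app_iff; simpl; tauto.
Qed.

(** Some slide of the cycle passes through [(0, 0)]. Read from there and closed up by a second
    [(0, 0)], it is the lift of a tour, and it ends where it begins. *)
Lemma cycle_nullhomotopic_tour m n l :
  0 < n -> 3 <= m -> cycle l -> transversal m n l -> has_nullhomotopic_tour m n.
Proof.
  intros hn hm C0 T0.
  destruct (trans_cover _ _ _ T0 (0, 0)) as (x & Hx & O); [unfold in_strip; simpl; lia|].
  apply same_orbit_slide in O as [k O].
  destruct (cycle_from (map (slide m n k) l) (0, 0))
    as (l' & P & C & t & El).
  { apply cycle_map; [apply knight_move_slide | exact C0]. }
  { rewrite <- O; apply in_map; exact Hx. }
  assert (T : transversal m n l')
    by (eapply transversal_perm; [exact P | apply transversal_slide; assumption]).
  clear l k C0 T0 x Hx O P; rename l' into l.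
  pose proof (transversal_length _ _ _ hn hm T) as L.
  destruct T as [S N I V].
  set (w := l ++ [(0, 0)]).
  assert (Ew : cyclic_steps l = steps w)
    by (unfold w, cyclic_steps; rewrite El; reflexivity).
  assert (Lw : length w = Datatypes.S (length l))
    by (unfold w; rewrite length_app; simpl; lia).
  assert (W : forall i, (i < length l)%nat -> nth i w (0, 0) = nth i l (0, 0))
    by (intros i Hi; unfold w; apply app_nth1; exact Hi).
  assert (W0 : nth 0 w (0, 0) = (0, 0)) by (unfold w; rewrite El; reflexivity).
  assert (Wk : nth (length l) w (0, 0) = (0, 0))
    by (unfold w; rewrite nth_middle; reflexivity).
  assert (D : forall i j, (i < length l)%nat -> (j < length l)%nat ->
            same_orbit m n (nth i w (0, 0)) (nth j w (0, 0)) -> i = j).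
  { intros i j Hi Hj O; rewrite !W in O by assumption.
    apply (proj1 (NoDup_nth l (0, 0)) N); auto.
    apply I; auto; apply nth_In; assumption. }
  exists w; split; [|unfold w; apply last_last].
  refine (conj (conj _ _) (conj W0 (conj _ (conj _ (conj _ _))))).
  - unfold w; intros E; apply app_eq_nil in E as [_ E]; discriminate.
  - intros i Hi; split; [|split].
    + apply S; rewrite W by lia; apply nth_In; lia.
    + apply S; destruct (Nat.eq_dec i (length l - 1)) as [-> | Hi'].
      * replace (Datatypes.S (length l - 1)) with (length l) by lia.
        rewrite Wk, El; left; reflexivity.
      * rewrite W by lia; apply nth_In; lia.
    + apply C; rewrite Ew; apply in_steps_nth; assumption.
  - exists 0; unfold w; rewrite last_last; reflexivity.
  - intros i j Hij Hj O; apply D in O; lia.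
  - intros i j Hij Hj (k & [[O _] | [O1 O2]]).
    + assert (i = j) by (apply D; [lia..| exists k; exact O]); lia.
    (* Edges matched with opposite orientation must be consecutive, with the end of the second in
       the orbit of the start of the first; this happens only for a cycle of two cells, which [L]
       excludes. *)
    + assert (Hj' : Datatypes.S i = j) by (apply D; [lia..| exists k; exact O2]).
      destruct (Nat.eq_dec (Datatypes.S j) (length l)) as [E | E].
      * rewrite E in O1; rewrite Wk in O1; rewrite <- W0 in O1 at 2.
        assert (i = 0%nat) by (apply D; [lia..| exists k; exact O1]); lia.
      * assert (i = Datatypes.S j) by (apply D; [lia..| exists k; exact O1]); lia.
  - intros a b Ha Hb; destruct (V (a, b) Ha) as (x & Hx & O).
    apply In_nth with (d := (0, 0)) in Hx as (i & Hi & <-).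
    exists i; rewrite W by lia; split; [lia | exact O].
Qed.

(** * Enumerations of finite regions *)

Definition zrange (n : Z) : list Z := map Z.of_nat (seq 0 (Z.to_nat n)).

Definition rect (m n : Z) : list cell := list_prod (zrange m) (zrange n).

Definition enumerates (dom l : list cell) : Prop :=
  NoDup l /\ forall x, In x l <-> In x dom.

Lemma in_zrange n x : In x (zrange n) <-> 0 <= x < n.
Proof.
  unfold zrange; rewrite in_map_iff; split.
  - intros (i & <- & H); apply in_seq in H; lia.
  - intros H; exists (Z.to_nat x); rewrite in_seq; lia.
Qed.

Lemma in_rect m n x : In x (rect m n) <-> 0 <= fst x < m /\ 0 <= snd x < n.
Proof.
  destruct x as [a b]; unfold rect, cell.
  rewrite in_prod_iff, !in_zrange; reflexivity.
Qed.

Lemma NoDup_zrange n : NoDup (zrange n).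
Proof.
  apply NoDup_map_NoDup_ForallPairs; [|apply seq_NoDup].
  intros i j _ _; lia.
Qed.

Lemma NoDup_list_prod {A B : Type} (l : list A) (l' : list B) :
  NoDup l -> NoDup l' -> NoDup (list_prod l l').
Proof.
  intros N N'; induction N as [|x l Hx N IH]; [constructor|].
  simpl; apply NoDup_app; [|exact IH|].
  - apply NoDup_map_NoDup_ForallPairs; [|exact N'].
    intros y z _ _ E; congruence.
  - intros [u v] H1 H2; apply in_map_iff in H1 as (y & E & _).
    apply in_prod_iff in H2 as [H2 _]; congruence.
Qed.

Lemma NoDup_rect m n : NoDup (rect m n).
Proof. apply NoDup_list_prod; apply NoDup_zrange. Qed.

Lemma enumerates_rect m n l :
  enumerates (rect m n) l <->
  NoDup l /\ forall x, In x l <-> 0 <= fst x < m /\ 0 <= snd x < n.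
Proof.
  split; intros [N H]; split; auto; intros x; specialize (H x);
    rewrite in_rect in *; tauto.
Qed.

Lemma enumerates_perm dom l l' :
  Permutation l l' -> enumerates dom l -> enumerates dom l'.
Proof.
  intros P [N H]; split; [rewrite <- P; exact N|].
  intros x; rewrite <- P; apply H.
Qed.

(** * Boolean tests that certify explicit tours *)

Definition cell_eqb (p q : cell) : bool :=
  (fst p =? fst q) && (snd p =? snd q).

Definition stripb (m : Z) (p : cell) : bool := (0 <=? fst p) && (fst p <? m).

Definition knightb (p q : cell) : bool :=
  let x := Z.abs (fst p - fst q) in let y := Z.abs (snd p - snd q) in
  (x =? 1) && (y =? 2) || (x =? 2) && (y =? 1).

Definition knightsb (s : list (cell * cell)) : bool :=
  forallb (fun e => knightb (fst e) (snd e)) s.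

Definition linkb (s : list (cell * cell)) (p q : cell) : bool :=
  existsb (fun e => cell_eqb p (fst e) && cell_eqb q (snd e) ||
                    cell_eqb q (fst e) && cell_eqb p (snd e)) s.

(** Comparing lengths replaces a test for repetitions: by the pigeonhole principle a list that
    covers a duplicate-free [dom] and is no longer than it has neither repetitions nor foreign
    entries. *)
Definition enumeratesb (dom l : list cell) : bool :=
  (length l =? length dom)%nat && forallb (fun x => existsb (cell_eqb x) l) dom.

Lemma cell_eqb_eq p q : cell_eqb p q = true <-> p = q.
Proof.
  destruct p as [a b], q as [c d]; unfold cell_eqb; cbn [fst snd].
  rewrite andb_true_iff, !Z.eqb_eq; split; [intros [-> ->]; reflexivity|].
  intros E; injection E; auto.
Qed.

Lemma stripb_in_strip m p : stripb m p = true -> in_strip m p.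
Proof. unfold stripb, in_strip; lia. Qed.

Lemma knightb_move p q : knightb p q = true <-> knight_move p q.
Proof. unfold knightb, knight_move; lia. Qed.

Lemma knightsb_moves s :
  knightsb s = true -> forall x y, In (x, y) s -> knight_move x y.
Proof.
  unfold knightsb; rewrite forallb_forall; intros H x y Hxy.
  apply knightb_move; exact (H _ Hxy).
Qed.

Lemma linkb_links s p q : linkb s p q = true -> links s p q.
Proof.
  unfold linkb; rewrite existsb_exists; intros ([x y] & H & E); cbn [fst snd] in E.
  rewrite orb_true_iff, !andb_true_iff, !cell_eqb_eq in E.
  destruct E as [[-> ->] | [-> ->]]; [left | right]; exact H.
Qed.

Lemma enumeratesb_enumerates dom l :
  NoDup dom -> enumeratesb dom l = true -> enumerates dom l.
Proof.
  unfold enumeratesb; rewrite andb_true_iff, Nat.eqb_eq, forallb_forall.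
  intros N [E H].
  assert (I : incl dom l).
  { intros x Hx; apply H, existsb_exists in Hx as (y & Hy & Exy).
    apply cell_eqb_eq in Exy as ->; exact Hy. }
  split.
  - apply (NoDup_incl_NoDup N); [lia | exact I].
  - intros x; split; [revert x | apply I].
    apply NoDup_length_incl; [exact N | lia | exact I].
Qed.

Lemma NoDup_map_inj {A B : Type} (f : A -> B) l x y :
  NoDup (map f l) -> In x l -> In y l -> f x = f y -> x = y.
Proof.
  induction l as [|z l IH]; simpl; [tauto|].
  intros N Hx Hy E; inversion N as [|z' l' Hz N' Ez].
  destruct Hx as [Hx | Hx], Hy as [Hy | Hy]; [congruence | | | auto];
    destruct Hz; [rewrite Hx, E | rewrite Hy, <- E]; apply in_map; assumption.
Qed.

Lemma transversal_normal_form m n l :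
  0 < n -> (forall x, In x l -> in_strip m x) ->
  enumerates (rect m n) (map (normal_form m n) l) -> transversal m n l.
Proof.
  intros hn S [N H]; split; [exact S | exact (NoDup_map_inv _ _ N) | |].
  - intros x y Hx Hy E; apply same_orbit_normal_form in E; [|exact hn].
    exact (NoDup_map_inj _ _ _ _ N Hx Hy E).
  - intros p Hp; pose proof (normal_form_box m n p hn Hp) as B.
    apply in_rect, H, in_map_iff in B as (x & E & Hx).
    exists x; split; [exact Hx | apply same_orbit_normal_form; assumption].
Qed.

Lemma transversal_rect m n l :
  0 < n -> enumerates (rect m n) l -> transversal m n l.
Proof.
  intros hn E; pose proof E as [N H]; setoid_rewrite in_rect in H.
  apply transversal_normal_form; [exact hn | intros x Hx; apply H; exact Hx |].
  replace (map (normal_form m n) l) with l; [exact E|].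
  rewrite <- (map_id l) at 1; apply map_ext_in; intros [a b] Hx.
  apply H in Hx; rewrite normal_form_id; [reflexivity | apply Hx].
Qed.

Definition tourb (m n : Z) (l : list cell) : bool :=
  knightsb (cyclic_steps l) && forallb (stripb m) l &&
  enumeratesb (rect m n) (map (normal_form m n) l).

Lemma tourb_tour m n l :
  0 < n -> tourb m n l = true -> cycle l /\ transversal m n l.
Proof.
  intros hn; unfold tourb; rewrite !andb_true_iff; intros [[K S] E]; split.
  - exact (knightsb_moves _ K).
  - apply transversal_normal_form; [exact hn | |].
    + rewrite forallb_forall in S; intros x Hx; apply stripb_in_strip; auto.
    + apply enumeratesb_enumerates; [apply NoDup_rect | exact E].
Qed.

Lemma nullhomotopic_tour_base m n l :
  0 < n -> 3 <= m -> tourb m n l = true -> has_nullhomotopic_tour m n.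
Proof.
  intros hn hm H; destruct (tourb_tour m n l hn H) as [C T].
  exact (cycle_nullhomotopic_tour m n l hn hm C T).
Qed.

(** The trivial walk is given by hand, as [cycle [(0, 0)]] would demand a knight move from [(0, 0)]
    to itself. *)
Lemma nullhomotopic_tour_1_1 : has_nullhomotopic_tour 1 1.
Proof.
  exists [(0, 0)]; split; [|reflexivity].
  refine (conj (conj _ _) (conj eq_refl (conj _ (conj _ (conj _ _))))).
  - discriminate.
  - simpl; lia.
  - exists 0; reflexivity.
  - simpl; lia.
  - simpl; lia.
  - intros a b Ha Hb; exists 0%nat; split; [simpl; lia|].
    exists 0; simpl; f_equal; lia.
Qed.

(** The 3 by 6 and 3 by 8 rectangles have no closed tour, so these two lifts wander beyond a single
    copy of the rectangle. *)
Lemma nullhomotopic_tour_3_6 : has_nullhomotopic_tour 3 6.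
Proof.
  apply (nullhomotopic_tour_base 3 6
    [(0,0); (1,2); (2,0); (1,-2); (2,-4); (0,-3); (2,-2); (1,0); (0,-2);
     (2,-1); (1,1); (0,-1); (1,-3); (2,-5); (0,-4); (2,-3); (1,-1); (2,1)]);
  [lia.. | vm_compute; reflexivity].
Qed.

Lemma nullhomotopic_tour_3_8 : has_nullhomotopic_tour 3 8.
Proof.
  apply (nullhomotopic_tour_base 3 8
    [(0,0); (1,-2); (2,-4); (1,-6); (0,-8); (2,-7); (1,-9); (0,-7); (1,-5);
     (0,-3); (2,-2); (1,-4); (0,-6); (2,-5); (0,-4); (2,-3); (0,-2); (1,0);
     (0,2); (2,3); (1,1); (0,-1); (1,-3); (2,-1)]);
  [lia.. | vm_compute; reflexivity].
Qed.

Definition shift (d e : Z) (p : cell) : cell := (fst p + d, snd p + e).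

Lemma shift_inj d e p q : shift d e p = shift d e q -> p = q.
Proof.
  destruct p, q; unfold shift; cbn [fst snd]; intros E; injection E as E1 E2.
  f_equal; lia.
Qed.

Lemma in_map_shift d e l x :
  In x (map (shift d e) l) <-> In (fst x - d, snd x - e) l.
Proof.
  destruct x as [a b]; rewrite in_map_iff; cbn [fst snd]; split.
  - intros ([u v] & E & H); unfold shift in E; cbn [fst snd] in E.
    injection E as <- <-; rewrite !Z.add_simpl_r; exact H.
  - intros H; eexists; split; [|exact H].
    unfold shift; cbn [fst snd]; f_equal; lia.
Qed.

Lemma NoDup_map_shift d e l : NoDup l -> NoDup (map (shift d e) l).
Proof.
  intros N; apply NoDup_map_NoDup_ForallPairs; [|exact N].
  intros x y _ _; apply shift_inj.
Qed.

Lemma knight_move_shift d e p q :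
  knight_move p q -> knight_move (shift d e p) (shift d e q).
Proof. unfold knight_move, shift; cbn [fst snd]; lia. Qed.

Lemma path_shift d e l p q :
  path l p q -> path (map (shift d e) l) (shift d e p) (shift d e q).
Proof.
  intros (W & (t & E) & (u & E')); repeat split.
  - intros x y; rewrite steps_map; intros H.
    apply in_map_iff in H as ([v w] & F & H); injection F as <- <-.
    apply knight_move_shift; auto.
  - exists (map (shift d e) t); rewrite E; reflexivity.
  - exists (map (shift d e) u); rewrite E', map_app; reflexivity.
Qed.

Lemma path_base l p q d :
  knightsb (steps l) = true -> hd_error l = Some p -> last l d = q -> path l p q.
Proof.
  intros K H E; split; [exact (knightsb_moves _ K)|].
  destruct l as [|x l]; [discriminate|]; injection H as ->.
  split; [exists l; reflexivity|].
  destruct (@exists_last _ (p :: l)) as (u & y & F); [discriminate|].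
  rewrite F, last_last in E; subst y; exists u; exact F.
Qed.

(** * Widening the board by an annulus *)

(** The link from [(0, 0)] to [(1, 2)] is the one that gets rerouted through the next
    annulus. *)
Definition strip_tour (m n : Z) : Prop :=
  exists l, cycle l /\ transversal m n l /\ links (cyclic_steps l) (0, 0) (1, 2).

Lemma strip_tour_base m n l :
  0 < n -> tourb m n l && linkb (cyclic_steps l) (0, 0) (1, 2) = true ->
  strip_tour m n.
Proof.
  rewrite andb_true_iff; intros hn [H E].
  destruct (tourb_tour m n l hn H) as [C T].
  exists l; split; [exact C|]. split; [exact T | exact (linkb_links _ _ _ E)].
Qed.

(** The tour of the narrower board is moved by [(3, c)]. *)
Definition annulusb (n : Z) (l : list cell) (c : Z) : bool :=
  knightsb (steps l) && knightb (3, c) (hd (0, 0) l) &&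
  knightb (4, c + 2) (last l (0, 0)) && linkb (steps l) (0, 0) (1, 2) &&
  forallb (stripb 3) l &&
  enumeratesb (rect 3 (2 * n)) (map (fun p => (fst p, snd p mod (2 * n))) l).

(** The columns [0, 1, 2] and their mirror images form an annulus of circumference
    [2 n] around the Möbius strip of width [m], so a transversal of the annulus is
    a set of representatives of [b] modulo [2 n] in these three columns. *)
Lemma transversal_widen m n c w l :
  0 < n -> 0 < m -> transversal m n w -> (forall x, In x l -> in_strip 3 x) ->
  enumerates (rect 3 (2 * n)) (map (fun p => (fst p, snd p mod (2 * n))) l) ->
  transversal (m + 6) n (map (shift 3 c) w ++ l).
Proof.
  intros hn hm [S N I V] Sl [Nl Hl]; setoid_rewrite in_rect in Hl.
  assert (Sw : forall x, In x (map (shift 3 c) w) -> 3 <= fst x < m + 3).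
  { intros [a b] Hx; rewrite in_map_shift in Hx; apply S in Hx.
    unfold in_strip in Hx; cbn [fst snd] in *; lia. }
  (* The reflection of the wide strip maps columns [0, 1, 2] to [m + 3, m + 4, m + 5], so orbits of
     annulus cells never enter the middle. *)
  assert (A : forall k a b, in_strip 3 (a, b) ->
            3 <= fst (slide (m + 6) n k (a, b)) < m + 3 -> False).
  { intros k a b; unfold in_strip, slide; cbn [fst snd].
    destruct (Z.even k); lia. }
  assert (O : forall x y, same_orbit (m + 6) n x y ->
            same_orbit (m + 6) n y x)
    by (intros x y; rewrite !same_orbit_normal_form by lia; auto).
  split.
  - intros x Hx; apply in_app_or in Hx as [Hx | Hx];
      [apply Sw in Hx | apply Sl in Hx]; unfold in_strip in *; lia.
  - apply NoDup_app; [apply NoDup_map_shift; exact N | exact (NoDup_map_inv _ _ Nl) |].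
    intros x H1 H2; apply Sw in H1; apply Sl in H2; unfold in_strip in *; lia.
  - intros x y Hx Hy E.
    apply in_app_or in Hx as [Hx | Hx]; apply in_app_or in Hy as [Hy | Hy].
    + destruct x as [a b], y as [a' b'].
      rewrite in_map_shift in Hx, Hy; cbn [fst snd] in Hx, Hy.
      assert (F : (a - 3, b - c) = (a' - 3, b' - c)).
      { apply I; auto; apply same_orbit_slide in E as [k E].
        apply same_orbit_slide; exists k.
        unfold slide in *; cbn [fst snd] in *; injection E as E1 E2.
        destruct (Z.even k); f_equal; lia. }
      injection F as F1 F2; f_equal; lia.
    + exfalso; apply O, same_orbit_slide in E as [k E]; apply Sw in Hx.
      rewrite <- E in Hx; destruct y as [a b]; apply (A k a b); auto.
    + exfalso; apply same_orbit_slide in E as [k E]; apply Sw in Hy.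
      rewrite <- E in Hy; destruct x as [a b]; apply (A k a b); auto.
    + apply same_orbit_slide in E as [k E].
      (* An odd slide would leave the three left columns; an even one moves [b] by a multiple of
         [2 * n], which is invisible modulo [2 * n]. *)
      assert (Ek : Z.even k = true).
      { pose proof (Sl _ Hx) as H1; pose proof (Sl _ Hy) as H2; rewrite <- E in H2.
        unfold in_strip, slide in *; cbn [fst snd] in *.
        destruct (Z.even k); [reflexivity | lia]. }
      apply Z.even_spec in Ek as [j ->].
      assert (F : (fst x, snd x mod (2 * n)) = (fst y, snd y mod (2 * n))).
      { rewrite <- E; unfold slide; cbn [fst snd].
        rewrite Z.even_mul; cbn [Z.even orb].
        replace (snd x + 2 * j * n) with (snd x + j * (2 * n)) by lia.
        rewrite Z.mod_add by lia; reflexivity. }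
      exact (NoDup_map_inj _ _ _ _ Nl Hx Hy F).
  - assert (V3 : forall a b, 0 <= a < 3 ->
              exists x, In x l /\ exists k, slide (m + 6) n k x = (a, b)).
    { intros a b Ha.
      assert (H : In (a, b mod (2 * n)) (map (fun p => (fst p, snd p mod (2 * n))) l))
        by (apply Hl; cbn [fst snd]; split; [lia | apply Z.mod_pos_bound; lia]).
      apply in_map_iff in H as ([u v] & E & H); cbn [fst snd] in E.
      apply pair_equal_spec in E as [-> E]; exists (a, v); split; [exact H|].
      exists (2 * (b / (2 * n) - v / (2 * n))).
      unfold slide; cbn [fst snd]; rewrite Z.even_mul; cbn [Z.even orb]; f_equal.
      pose proof (Z.div_mod b (2 * n)); pose proof (Z.div_mod v (2 * n)); lia. }
    assert (T : forall k x y, slide (m + 6) n k x = y -> same_orbit (m + 6) n x y)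
      by (intros k x y E; apply same_orbit_slide; exists k; exact E).
    intros [a b]; unfold in_strip; cbn [fst snd]; intros Ha.
    setoid_rewrite in_app_iff.
    destruct (Z_lt_dec a 3) as [Ha3 | Ha3]; [|destruct (Z_lt_dec a (m + 3)) as [Hm | Hm]].
    + destruct (V3 a b) as (x & Hx & k & E); [lia|].
      exists x; split; [right; exact Hx | exact (T _ _ _ E)].
    + destruct (V (a - 3, b - c)) as (x & Hx & E); [unfold in_strip; cbn [fst]; lia|].
      exists (shift 3 c x); split; [left; apply in_map; exact Hx|].
      apply same_orbit_slide in E as [k E]; apply (T k).
      unfold slide, shift in *; cbn [fst snd] in *; injection E as E1 E2.
      destruct (Z.even k); f_equal; lia.
    (* A cell of the three right columns is covered through its image under [sigma], which lies in
       the left columns; one slide back gives [k - 1]. *)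
    + destruct (V3 (m + 6 - 1 - a) (b + n)) as (x & Hx & k & E); [lia|].
      exists x; split; [right; exact Hx|]; apply (T (k - 1)).
      unfold slide in *; cbn [fst snd] in *; injection E as E1 E2.
      rewrite even_pred_negb; destruct (Z.even k); cbn [negb]; f_equal; lia.
Qed.

(** The width grows by 6 because the annulus occupies three columns on either side. The rerouted
    link is the shifted one from [(3, c)] to [(4, c + 2)], and [l] itself supplies the new link from
    [(0, 0)] to [(1, 2)]. *)
Lemma strip_tour_step m n l c :
  0 < n -> 0 < m -> annulusb n l c = true -> strip_tour m n -> strip_tour (m + 6) n.
Proof.
  intros hn hm R (w & C & T & E); unfold annulusb in R.
  rewrite !andb_true_iff in R; destruct R as [[[[[W K1] K2] X] S] D].
  apply knightb_move in K1, K2; apply linkb_links in X.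
  apply enumeratesb_enumerates in D; [|apply NoDup_rect].
  destruct (insert_path (map (shift 3 c) w) l (3, c) (4, c + 2)
              (hd (0, 0) l) (last l (0, 0))) as (w' & C' & P & _ & L); auto.
  - apply cycle_map; [apply knight_move_shift | exact C].
  - apply (links_map (shift 3 c)) in E; unfold shift in E at 2 3.
    cbn [fst snd] in E; rewrite (Z.add_comm 2) in E; exact E.
  - destruct l as [|x l]; [destruct X as [[] | []]|].
    apply (path_base _ _ _ (0, 0)); [exact W | reflexivity | reflexivity].
  - exists w'; split; [exact C'|]. split; [|apply L; exact X].
    apply (transversal_perm _ _ _ _ (Permutation_sym P)).
    apply transversal_widen; auto.
    rewrite forallb_forall in S; intros x Hx; apply stripb_in_strip; auto.
Qed.

Definition annulus1 : list cell :=
  [(1,-3); (0,-1); (2,0); (1,2); (0,0); (2,1)].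

Lemma strip_tour_step1 m : 0 < m -> strip_tour m 1 -> strip_tour (m + 6) 1.
Proof.
  intros hm; apply (strip_tour_step m 1 annulus1 (-2));
    [lia.. | vm_compute; reflexivity].
Qed.

Definition annulus2 : list cell :=
  [(1,-4); (0,-2); (2,-1); (1,1); (0,3); (2,4); (1,2); (0,0); (2,1); (1,-1);
   (0,-3); (2,-2)].

Lemma strip_tour_step2 m : 0 < m -> strip_tour m 2 -> strip_tour (m + 6) 2.
Proof.
  intros hm; apply (strip_tour_step m 2 annulus2 (-3));
    [lia.. | vm_compute; reflexivity].
Qed.

Definition annulus3 : list cell :=
  [(1,-2); (0,0); (1,2); (2,0); (0,-1); (2,-2); (1,0); (0,-2); (2,-1);
   (1,-3); (2,-5); (0,-4); (2,-3); (1,-5); (0,-3); (1,-1); (0,1); (2,2)].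

Lemma strip_tour_step3 m : 0 < m -> strip_tour m 3 -> strip_tour (m + 6) 3.
Proof.
  intros hm; apply (strip_tour_step m 3 annulus3 (-1));
    [lia.. | vm_compute; reflexivity].
Qed.

Definition annulus4 : list cell :=
  [(1,-2); (2,-4); (0,-3); (2,-2); (0,-1); (2,0); (1,2); (0,0); (2,1);
   (1,-1); (0,1); (1,3); (2,5); (0,4); (2,3); (1,5); (0,3); (1,1); (2,-1);
   (0,-2); (1,0); (0,2); (1,4); (2,2)].

Lemma strip_tour_step4 m : 0 < m -> strip_tour m 4 -> strip_tour (m + 6) 4.
Proof.
  intros hm; apply (strip_tour_step m 4 annulus4 (-1));
    [lia.. | vm_compute; reflexivity].
Qed.

Lemma strip_tour_6_1 : strip_tour 6 1.
Proof.
  apply (strip_tour_base 6 1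
    [(1,2); (3,3); (5,2); (4,0); (2,1); (0,0)]);
  [lia | vm_compute; reflexivity].
Qed.

Lemma strip_tour_8_1 : strip_tour 8 1.
Proof.
  apply (strip_tour_base 8 1
    [(1,2); (2,4); (0,3); (1,1); (3,2); (4,0); (2,-1); (0,0)]);
  [lia | vm_compute; reflexivity].
Qed.

Lemma strip_tour_10_1 : strip_tour 10 1.
Proof.
  apply (strip_tour_base 10 1
    [(1,2); (3,1); (4,-1); (2,-2); (0,-3); (1,-1); (3,0); (4,2); (2,1);
     (0,0)]);
  [lia | vm_compute; reflexivity].
Qed.

Lemma strip_tour_3_2 : strip_tour 3 2.
Proof.
  apply (strip_tour_base 3 2
    [(1,2); (2,0); (0,-1); (1,1); (2,-1); (0,0)]);
  [lia | vm_compute; reflexivity].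
Qed.

Lemma strip_tour_4_2 : strip_tour 4 2.
Proof.
  apply (strip_tour_base 4 2
    [(1,2); (3,3); (2,1); (0,2); (1,0); (3,1); (2,-1); (0,0)]);
  [lia | vm_compute; reflexivity].
Qed.

Lemma strip_tour_5_2 : strip_tour 5 2.
Proof.
  apply (strip_tour_base 5 2
    [(1,2); (3,3); (4,1); (2,2); (4,3); (3,5); (1,4); (0,2); (2,1); (0,0)]);
  [lia | vm_compute; reflexivity].
Qed.

Lemma strip_tour_6_2 : strip_tour 6 2.
Proof.
  apply (strip_tour_base 6 2
    [(1,2); (2,0); (0,1); (1,-1); (2,1); (0,2); (1,4); (2,2); (0,3); (1,1);
     (2,-1); (0,0)]);
  [lia | vm_compute; reflexivity].
Qed.

Lemma strip_tour_7_2 : strip_tour 7 2.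
Proof.
  apply (strip_tour_base 7 2
    [(1,2); (3,1); (1,0); (0,2); (2,1); (1,-1); (0,-3); (2,-4); (0,-5);
     (2,-6); (3,-4); (1,-3); (2,-1); (0,0)]);
  [lia | vm_compute; reflexivity].
Qed.

Lemma strip_tour_8_2 : strip_tour 8 2.
Proof.
  apply (strip_tour_base 8 2
    [(1,2); (3,1); (2,-1); (0,-2); (1,0); (3,-1); (5,0); (7,-1); (5,-2);
     (7,-3); (6,-1); (4,0); (6,1); (4,2); (2,1); (0,0)]);
  [lia | vm_compute; reflexivity].
Qed.

Lemma strip_tour_6_3 : strip_tour 6 3.
Proof.
  apply (strip_tour_base 6 3
    [(1,2); (0,4); (1,6); (0,8); (1,10); (3,11); (5,12); (3,13); (5,14);
     (4,12); (5,10); (3,9); (2,7); (1,5); (2,3); (1,1); (2,-1); (0,0)]);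
  [lia | vm_compute; reflexivity].
Qed.

Lemma strip_tour_8_3 : strip_tour 8 3.
Proof.
  apply (strip_tour_base 8 3
    [(1,2); (0,4); (1,6); (0,8); (1,10); (2,8); (0,9); (1,11); (0,13);
     (2,12); (3,10); (4,12); (5,10); (4,8); (5,6); (6,4); (7,2); (6,0);
     (4,-1); (5,1); (3,0); (4,-2); (2,-1); (0,0)]);
  [lia | vm_compute; reflexivity].
Qed.

Lemma strip_tour_10_3 : strip_tour 10 3.
Proof.
  apply (strip_tour_base 10 3
    [(1,2); (0,4); (2,3); (4,2); (5,0); (3,-1); (5,-2); (3,-3); (2,-5);
     (1,-7); (3,-8); (5,-9); (4,-7); (6,-8); (7,-10); (5,-11); (3,-12);
     (2,-10); (0,-9); (1,-11); (3,-10); (2,-12); (0,-11); (1,-9); (0,-7);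
     (2,-8); (1,-6); (0,-4); (1,-2); (0,0)]);
  [lia | vm_compute; reflexivity].
Qed.

Lemma strip_tour_4_4 : strip_tour 4 4.
Proof.
  apply (strip_tour_base 4 4
    [(1,2); (3,1); (1,0); (3,-1); (2,-3); (0,-4); (1,-2); (3,-3); (2,-5);
     (0,-6); (2,-7); (3,-5); (1,-4); (0,-2); (2,-1); (0,0)]);
  [lia | vm_compute; reflexivity].
Qed.

Lemma strip_tour_5_4 : strip_tour 5 4.
Proof.
  apply (strip_tour_base 5 4
    [(1,2); (0,4); (1,6); (2,8); (0,7); (1,5); (0,3); (1,1); (2,3); (0,2);
     (1,4); (0,6); (1,8); (2,6); (0,5); (1,3); (0,1); (1,-1); (2,1); (0,0)]);
  [lia | vm_compute; reflexivity].
Qed.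

Lemma strip_tour_6_4 : strip_tour 6 4.
Proof.
  apply (strip_tour_base 6 4
    [(1,2); (0,4); (1,6); (2,4); (0,5); (1,7); (0,9); (2,8); (3,6); (4,8);
     (5,10); (3,9); (4,7); (3,5); (5,6); (3,7); (1,8); (2,6); (0,7); (1,5);
     (0,3); (1,1); (2,-1); (0,0)]);
  [lia | vm_compute; reflexivity].
Qed.

Lemma strip_tour_7_4 : strip_tour 7 4.
Proof.
  apply (strip_tour_base 7 4
    [(1,2); (0,4); (1,6); (2,4); (0,5); (1,7); (0,9); (1,11); (2,9); (0,10);
     (1,12); (0,14); (1,16); (3,15); (2,13); (4,12); (3,14); (5,13); (6,11);
     (5,9); (6,7); (4,6); (3,4); (4,2); (2,3); (3,1); (2,-1); (0,0)]);
  [lia | vm_compute; reflexivity].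
Qed.

Lemma strip_tour_8_4 : strip_tour 8 4.
Proof.
  apply (strip_tour_base 8 4
    [(1,2); (0,4); (1,6); (2,4); (3,6); (1,7); (3,8); (5,9); (3,10); (2,8);
     (0,7); (1,5); (0,3); (1,1); (2,3); (0,2); (1,0); (0,-2); (1,-4); (2,-2);
     (0,-3); (1,-5); (0,-7); (2,-6); (3,-4); (5,-5); (4,-7); (3,-5); (4,-3);
     (3,-1); (2,1); (0,0)]);
  [lia | vm_compute; reflexivity].
Qed.

Lemma strip_tour_9_4 : strip_tour 9 4.
Proof.
  apply (strip_tour_base 9 4
    [(1,2); (0,4); (1,6); (3,7); (2,5); (3,3); (4,5); (2,4); (0,3); (2,2);
     (3,0); (1,1); (3,2); (4,4); (3,6); (1,5); (0,7); (2,8); (4,7); (3,9);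
     (5,8); (4,10); (2,11); (3,13); (2,15); (0,14); (1,12); (0,10); (1,8);
     (2,6); (0,5); (1,3); (0,1); (1,-1); (2,1); (0,0)]);
  [lia | vm_compute; reflexivity].
Qed.

(** * Extending a board by four columns *)

(** The predicate [C] lets one extension argument serve both the 3 by [n] rectangle and the half
    board of width 4. *)
Definition region (C : cell -> bool) (n : Z) : list cell := filter C (rect 4 n).

Definition region_tour (C : cell -> bool) (n : Z) : Prop :=
  exists l, cycle l /\ enumerates (region C n) l /\
            links (cyclic_steps l) (0, n - 2) (2, n - 1).

Lemma NoDup_region C n : NoDup (region C n).
Proof. apply NoDup_filter, NoDup_rect. Qed.

Lemma in_region C n x :
  In x (region C n) <-> (0 <= fst x < 4 /\ 0 <= snd x < n) /\ C x = true.
Proof. unfold region; rewrite filter_In, in_rect; reflexivity. Qed.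

Lemma region_tour_base C n l :
  knightsb (cyclic_steps l) && enumeratesb (region C n) l &&
    linkb (cyclic_steps l) (0, n - 2) (2, n - 1) = true ->
  region_tour C n.
Proof.
  rewrite !andb_true_iff; intros [[K E] L]; exists l; split; [exact (knightsb_moves _ K)|].
  split; [apply enumeratesb_enumerates; [apply NoDup_region | exact E]|].
  apply linkb_links; exact L.
Qed.

(** The block of length four is moved to [b = n], where its ends [(1, n)] and [(0, n)] are a knight
    move away from the ends of the link at the border [b = n - 1]. Its own link from [(0, 2)] to
    [(2, 3)] becomes the link at the new border. *)
Lemma region_tour_step C n l :
  (forall a b j, C (a, b + 2 * j) = C (a, b)) ->
  knightsb (steps l) && cell_eqb (hd (0, 0) l) (1, 0) &&
    cell_eqb (last l (0, 0)) (0, 0) && linkb (steps l) (0, 2) (2, 3) &&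
    enumeratesb (region C 4) l = true ->
  0 <= n -> Z.even n = true -> region_tour C n -> region_tour C (n + 4).
Proof.
  intros per; rewrite !andb_true_iff, !cell_eqb_eq; intros [[[[W H1] H2] X] D].
  apply linkb_links in X; apply enumeratesb_enumerates in D as [Nl Hl];
    [|apply NoDup_region].
  intros hn ev (w & Cw & [Nw Hw] & Ew).
  assert (Pl : path l (1, 0) (0, 0)).
  { apply (path_base _ _ _ (0, 0)); [exact W | | exact H2].
    destruct l as [|x l]; [destruct X as [[] | []]|].
    simpl in H1; rewrite <- H1; reflexivity. }
  destruct (insert_path w (map (shift 0 n) l) (0, n - 2) (2, n - 1)
              (shift 0 n (1, 0)) (shift 0 n (0, 0))) as (w' & C' & P & _ & L); auto.
  - apply path_shift; exact Pl.
  - unfold knight_move, shift; cbn [fst snd]; lia.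
  - unfold knight_move, shift; cbn [fst snd]; lia.
  - exists w'; split; [exact C'|]. split.
    + apply (enumerates_perm _ _ _ (Permutation_sym P)); split.
      * apply NoDup_app; [exact Nw | apply NoDup_map_shift; exact Nl |].
        intros x Hx Hx'; rewrite in_map_shift in Hx'.
        apply Hw, in_region in Hx; apply Hl, in_region in Hx'.
        cbn [fst snd] in Hx'; lia.
      * intros [a b]; rewrite in_app_iff, in_map_shift, Hw, Hl, !in_region.
        cbn [fst snd].
        (* As [C] has period 2 in [b] and [n] is even, the moved block continues the pattern. *)
        assert (E : C (a - 0, b - n) = C (a, b)).
        { apply Z.even_spec in ev as [j ->].
          rewrite Z.sub_0_r, <- (per a (b - 2 * j) j), Z.sub_add; reflexivity. }
        rewrite E; destruct (C (a, b)); intuition lia.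
    + specialize (L (shift 0 n (0, 2)) (shift 0 n (2, 3))).
      unfold shift in L at 2 3; cbn [fst snd] in L.
      replace (n + 4 - 2) with (2 + n) by lia; replace (n + 4 - 1) with (3 + n) by lia.
      apply L; rewrite steps_map; destruct X as [X | X]; [left | right];
        exact (in_map (fun e => (shift 0 n (fst e), shift 0 n (snd e))) _ _ X).
Qed.

Definition three_rows (x : cell) : bool := fst x <? 3.

(** In width 4 these are the border cells with [a + b] even and the inner cells with [a + b] odd. *)
Definition half_board (x : cell) : bool := Bool.eqb (Z.even (snd x)) (fst x <? 2).

Lemma three_rows_step n :
  0 <= n -> Z.even n = true -> region_tour three_rows n -> region_tour three_rows (n + 4).
Proof.
  apply (region_tour_step _ _
    [(1,0); (2,2); (0,3); (1,1); (2,3); (0,2); (2,1); (1,3); (0,1); (2,0); (1,2);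
     (0,0)]); [reflexivity | vm_compute; reflexivity].
Qed.

Lemma half_board_step n :
  0 <= n -> Z.even n = true -> region_tour half_board n -> region_tour half_board (n + 4).
Proof.
  apply (region_tour_step _ _
    [(1,0); (0,2); (2,3); (3,1); (1,2); (3,3); (2,1); (0,0)]);
    [|vm_compute; reflexivity].
  intros a b j; unfold half_board; cbn [fst snd].
  rewrite Z.even_add, Z.even_mul; cbn [Z.even orb].
  destruct (Z.even b); reflexivity.
Qed.

Lemma three_rows_10 : region_tour three_rows 10.
Proof.
  apply (region_tour_base _ _
    [(0,0); (2,1); (0,2); (1,0); (2,2); (1,4); (0,6); (1,8); (2,6); (0,5);
     (2,4); (0,3); (1,1); (2,3); (1,5); (0,7); (1,9); (2,7); (0,8); (2,9);
     (1,7); (0,9); (2,8); (1,6); (0,4); (2,5); (1,3); (0,1); (2,0); (1,2)]);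
  vm_compute; reflexivity.
Qed.

Lemma three_rows_12 : region_tour three_rows 12.
Proof.
  apply (region_tour_base _ _
    [(0,0); (2,1); (1,3); (0,5); (2,4); (0,3); (1,1); (2,3); (1,5); (2,7);
     (0,6); (1,8); (0,10); (2,11); (1,9); (0,11); (2,10); (0,9); (1,11);
     (2,9); (1,7); (2,5); (0,4); (1,6); (0,8); (1,10); (2,8); (0,7); (2,6);
     (1,4); (0,2); (1,0); (2,2); (0,1); (2,0); (1,2)]);
  vm_compute; reflexivity.
Qed.

Lemma half_board_8 : region_tour half_board 8.
Proof.
  apply (region_tour_base _ _
    [(0,0); (2,1); (3,3); (1,4); (0,6); (2,7); (3,5); (1,6); (3,7); (2,5);
     (0,4); (2,3); (0,2); (1,0); (3,1); (1,2)]);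
  vm_compute; reflexivity.
Qed.

(** Lengthening by four preserves [n] modulo 4, so the even lengths need the two starting rectangles
    of length 10 and 12. *)
Lemma nullhomotopic_tour_3 n :
  10 <= n -> Z.even n = true -> has_nullhomotopic_tour 3 n.
Proof.
  intros hn ev.
  assert (R : forall j : nat, region_tour three_rows (10 + 4 * Z.of_nat j) /\
                              region_tour three_rows (12 + 4 * Z.of_nat j)).
  { induction j as [|j [IH1 IH2]]; [exact (conj three_rows_10 three_rows_12)|].
    rewrite Nat2Z.inj_succ, Z.mul_succ_r, !Z.add_assoc.
    split; apply three_rows_step; try lia; try assumption;
      rewrite Z.even_add, Z.even_mul; reflexivity. }
  assert (H : region_tour three_rows n).
  { apply Z.even_spec in ev as [i ->].
    pose proof (Z.div_mod (i - 5) 2) as D; pose proof (Z.mod_pos_bound (i - 5) 2).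
    destruct (R (Z.to_nat ((i - 5) / 2))) as [R1 R2].
    rewrite Z2Nat.id in R1, R2 by lia.
    destruct (Z.eq_dec ((i - 5) mod 2) 0).
    - replace (2 * i) with (10 + 4 * ((i - 5) / 2)) by lia; exact R1.
    - replace (2 * i) with (12 + 4 * ((i - 5) / 2)) by lia; exact R2. }
  destruct H as (l & C & [N E] & _).
  apply (cycle_nullhomotopic_tour 3 n l); [lia | lia | exact C |].
  apply transversal_rect; [lia|]; split; [exact N|].
  intros x; rewrite E, in_region, in_rect; unfold three_rows; lia.
Qed.

(** In a tour of width 4 border cells and inner cells alternate, so for even [n] all
    border cells of the lift have one colour and all inner cells the other: the lift
    lives on half of the cells, over [2 n] columns. *)
Lemma transversal_half_board n l :
  0 < n -> Z.even n = true -> enumerates (region half_board (2 * n)) l ->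
  transversal 4 n l.
Proof.
  intros hn ev [N H].
  assert (H' : forall a b, In (a, b) l <-> 0 <= b < 2 * n /\
            if Z.even b then 0 <= a < 2 else 2 <= a < 4).
  { intros a b; rewrite H, in_region; unfold half_board; cbn [fst snd].
    destruct (Z.even b), (Z.ltb_spec a 2); cbn [Bool.eqb]; intuition lia. }
  assert (ev' : forall b k, Z.even (b + k * n) = Z.even b)
    by (intros b k; rewrite Z.even_add, Z.even_mul, ev, orb_true_r;
        destruct (Z.even b); reflexivity).
  split.
  - intros x Hx; apply H, in_region in Hx; unfold in_strip; lia.
  - exact N.
  - intros [a b] [a' b'] Hx Hy E; apply same_orbit_slide in E as [k E].
    apply H' in Hx, Hy; unfold slide in E; cbn [fst snd] in E.
    apply pair_equal_spec in E as [E1 E2]; subst b'; rewrite ev' in Hy.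
    (* Both values of [b] lie in a window of length [2 * n], so at most one reflection is involved;
       it would exchange [a < 2] with [a >= 2] while keeping the parity of [b], against the shape of
       the half board. *)
    assert (B : -2 * n < k * n < 2 * n) by lia.
    rewrite <- !Z.mul_lt_mono_pos_r in B by exact hn.
    assert (Hk : k = -1 \/ k = 0 \/ k = 1) by lia.
    destruct Hk as [-> | [-> | ->]]; cbn [Z.even] in E1;
      [destruct (Z.even b); lia | f_equal; lia | destruct (Z.even b); lia].
  - intros [a b]; unfold in_strip; cbn [fst snd]; intros Ha.
    assert (M : forall c, Z.even (c mod (2 * n)) = Z.even c).
    { intros c; rewrite (Z.div_mod c (2 * n)) at 2 by lia.
      rewrite Z.even_add, <- Z.mul_assoc, Z.even_mul; cbn [Z.even orb].
      destruct (Z.even (c mod (2 * n))); reflexivity. }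
    assert (R : forall c, 0 <= c mod (2 * n) < 2 * n)
      by (intros c; apply Z.mod_pos_bound; lia).
    destruct (Bool.bool_dec (Z.even b) (a <? 2)) as [Eb | Eb].
    + exists (a, b mod (2 * n)); split.
      * apply H'; split; [apply R|]; rewrite M, Eb.
        destruct (Z.ltb_spec a 2); lia.
      * apply same_orbit_slide; exists (2 * (b / (2 * n))).
        unfold slide; cbn [fst snd]; rewrite Z.even_mul; cbn [Z.even orb].
        f_equal; pose proof (Z.div_mod b (2 * n)); lia.
    (* Of a cell and its image under [sigma], exactly one has the right colour, since [n] is even
       and [a] is reflected. *)
    + exists (3 - a, (b + n) mod (2 * n)); split.
      * apply H'; split; [apply R|]; rewrite M.
        rewrite <- (Z.mul_1_l n), ev'.
        destruct (Z.even b), (Z.ltb_spec a 2); try lia; destruct Eb; reflexivity.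
      * apply same_orbit_slide; exists (2 * ((b + n) / (2 * n)) - 1).
        unfold slide; cbn [fst snd]; rewrite even_pred_negb, Z.even_mul.
        cbn [Z.even orb negb].
        f_equal; [lia|]; pose proof (Z.div_mod (b + n) (2 * n)); lia.
Qed.

(** The half board has length [2 * n], so lengthening it by four raises [n] by two, and the single
    start [2 * n = 8] reaches every even [n >= 4]. *)
Lemma nullhomotopic_tour_4 n :
  4 <= n -> Z.even n = true -> has_nullhomotopic_tour 4 n.
Proof.
  intros hn ev.
  assert (R : forall j : nat, region_tour half_board (8 + 4 * Z.of_nat j)).
  { induction j as [|j IH]; [exact half_board_8|].
    rewrite Nat2Z.inj_succ, Z.mul_succ_r, Z.add_assoc.
    apply half_board_step; [lia | | exact IH].
    rewrite Z.even_add, Z.even_mul; reflexivity. }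
  pose proof ev as ev'; apply Z.even_spec in ev' as [i Ei].
  specialize (R (Z.to_nat (i - 2))).
  replace (8 + 4 * Z.of_nat (Z.to_nat (i - 2))) with (2 * n) in R by lia.
  destruct R as (l & C & E & _).
  apply (cycle_nullhomotopic_tour 4 n l); [lia | lia | exact C |].
  apply transversal_half_board; [lia | exact ev | exact E].
Qed.

(** * Rectangular boards *)

(** The first two links serve to attach a further board on the right or on top, the last
    two to be attached to such a board. *)
Definition rect_tour (m n : Z) : Prop :=
  exists l, cycle l /\ enumerates (rect m n) l /\
    links (cyclic_steps l) (m - 1, 0) (m - 2, 2) /\
    links (cyclic_steps l) (0, n - 1) (2, n - 2) /\
    links (cyclic_steps l) (1, 1) (0, 3) /\
    links (cyclic_steps l) (1, 1) (3, 0).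

Lemma rect_tour_base m n l :
  knightsb (cyclic_steps l) && enumeratesb (rect m n) l &&
    linkb (cyclic_steps l) (m - 1, 0) (m - 2, 2) &&
    linkb (cyclic_steps l) (0, n - 1) (2, n - 2) &&
    linkb (cyclic_steps l) (1, 1) (0, 3) &&
    linkb (cyclic_steps l) (1, 1) (3, 0) = true ->
  rect_tour m n.
Proof.
  rewrite !andb_true_iff; intros [[[[[K E] L1] L2] L3] L4].
  exists l; split; [exact (knightsb_moves _ K)|].
  split; [apply enumeratesb_enumerates; [apply NoDup_rect | exact E]|].
  auto using linkb_links.
Qed.

(** The diagonal reflection exchanges the first link with the second and the third with the fourth,
    so gluing in one direction suffices. *)
Lemma rect_tour_transpose m n : rect_tour m n -> rect_tour n m.
Proof.
  intros (l & C & E & L1 & L2 & L3 & L4).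
  set (t := fun p : cell => (snd p, fst p)).
  apply enumerates_rect in E as [N H].
  exists (map t l); split; [|split].
  - apply cycle_map; [|exact C]; unfold knight_move, t; cbn [fst snd]; lia.
  - apply enumerates_rect; split.
    + apply NoDup_map_NoDup_ForallPairs; [|exact N].
      intros [a b] [c d] _ _ F; unfold t in F; cbn [fst snd] in F; congruence.
    + intros [a b]; rewrite in_map_iff; split.
      * intros ([c d] & F & Hx); unfold t in F; cbn [fst snd] in *.
        injection F as <- <-; apply H in Hx; cbn [fst snd] in Hx; tauto.
      * cbn [fst snd]; intros Hx; exists (b, a); split; [reflexivity|].
        apply H; cbn [fst snd]; tauto.
  - apply (links_map t) in L1, L2, L3, L4; unfold t in L1, L2, L3, L4 at 2 3.
    cbn [fst snd] in L1, L2, L3, L4; auto.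
Qed.

(** The first link of the left board faces the third link of the right one at the distance of a
    knight move. Only these two are opened: the right board passes on its first link, the left board
    its other three. *)
Lemma rect_tour_glue m k n :
  5 <= m -> 5 <= k -> 5 <= n ->
  rect_tour m n -> rect_tour k n -> rect_tour (m + k) n.
Proof.
  intros hm hk hn (u & Cu & Eu & U1 & U2 & U3 & U4) (v & Cv & Ev & V1 & V2 & V3 & V4).
  apply enumerates_rect in Eu as [Nu Hu]; apply enumerates_rect in Ev as [Nv Hv].
  apply (links_map (shift m 0)) in V1, V3.
  unfold shift in V1, V3 at 2 3; cbn [fst snd] in V1, V3.
  destruct (glue_cycles u (map (shift m 0) v) (m - 1, 0) (m - 2, 2)
              (1 + m, 1 + 0) (0 + m, 3 + 0)) as (w & C & P & Lu & Lv); auto.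
  - apply cycle_map; [apply knight_move_shift | exact Cv].
  - unfold knight_move; cbn [fst snd]; lia.
  - unfold knight_move; cbn [fst snd]; lia.
  - exists w; split; [exact C|]. split.
    { apply (enumerates_perm _ _ _ (Permutation_sym P)), enumerates_rect; split.
      - apply NoDup_app; [exact Nu | apply NoDup_map_shift; exact Nv |].
        intros x H1 H2; apply Hu in H1; rewrite in_map_shift in H2; apply Hv in H2.
        cbn [fst snd] in H2; lia.
      - intros x; rewrite in_app_iff, in_map_shift, Hu, Hv; cbn [fst snd]; lia. }
    repeat split.
    + destruct (Lv _ _ V1) as [F | [F | L]]; [injection F; lia.. |].
      replace (m + k - 1) with (k - 1 + m) by lia.
      replace (m + k - 2) with (k - 2 + m) by lia; exact L.
    + destruct (Lu _ _ U2) as [F | [F | L]]; [injection F; lia.. | exact L].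
    + destruct (Lu _ _ U3) as [F | [F | L]]; [injection F; lia.. | exact L].
    + destruct (Lu _ _ U4) as [F | [F | L]]; [injection F; lia.. | exact L].
Qed.

Lemma rect_tour_5_6 : rect_tour 5 6.
Proof.
  apply (rect_tour_base 5 6
    [(0,0); (1,2); (3,1); (1,0); (0,2); (1,4); (3,5); (4,3); (2,2); (0,1);
     (2,0); (4,1); (3,3); (4,5); (2,4); (0,5); (1,3); (3,4); (1,5); (0,3);
     (1,1); (3,0); (4,2); (2,3); (0,4); (2,5); (4,4); (3,2); (4,0); (2,1)]);
  vm_compute; reflexivity.
Qed.

Lemma rect_tour_5_8 : rect_tour 5 8.
Proof.
  apply (rect_tour_base 5 8
    [(0,0); (1,2); (3,1); (1,0); (0,2); (2,3); (0,4); (1,6); (3,7); (4,5);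
     (3,3); (4,1); (2,0); (0,1); (1,3); (0,5); (1,7); (3,6); (4,4); (2,5);
     (4,6); (2,7); (0,6); (1,4); (3,5); (4,7); (2,6); (0,7); (1,5); (3,4);
     (4,2); (3,0); (1,1); (0,3); (2,2); (4,3); (2,4); (3,2); (4,0); (2,1)]);
  vm_compute; reflexivity.
Qed.

Lemma rect_tour_5_10 : rect_tour 5 10.
Proof.
  apply (rect_tour_base 5 10
    [(0,0); (2,1); (4,0); (3,2); (2,0); (4,1); (3,3); (4,5); (3,7); (4,9);
     (2,8); (0,9); (1,7); (2,9); (0,8); (1,6); (0,4); (2,5); (4,4); (3,6);
     (4,8); (2,7); (3,9); (1,8); (0,6); (1,4); (0,2); (1,0); (3,1); (2,3);
     (4,2); (3,0); (1,1); (0,3); (1,5); (0,7); (1,9); (3,8); (4,6); (3,4);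
     (2,2); (0,1); (1,3); (0,5); (2,6); (4,7); (3,5); (4,3); (2,4); (1,2)]);
  vm_compute; reflexivity.
Qed.

Lemma rect_tour_6_6 : rect_tour 6 6.
Proof.
  apply (rect_tour_base 6 6
    [(0,0); (2,1); (4,0); (5,2); (4,4); (2,5); (0,4); (2,3); (1,5); (0,3);
     (1,1); (3,0); (5,1); (3,2); (5,3); (4,5); (2,4); (0,5); (1,3); (0,1);
     (2,0); (4,1); (3,3); (5,4); (3,5); (1,4); (0,2); (1,0); (2,2); (4,3);
     (5,5); (3,4); (4,2); (5,0); (3,1); (1,2)]);
  vm_compute; reflexivity.
Qed.

Lemma rect_tour_6_8 : rect_tour 6 8.
Proof.
  apply (rect_tour_base 6 8
    [(0,0); (2,1); (4,0); (5,2); (4,4); (5,6); (3,7); (1,6); (0,4); (2,3);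
     (0,2); (1,0); (3,1); (5,0); (4,2); (5,4); (4,6); (2,7); (0,6); (2,5);
     (1,7); (0,5); (1,3); (0,1); (2,0); (3,2); (5,1); (3,0); (1,1); (0,3);
     (1,5); (0,7); (2,6); (4,7); (3,5); (1,4); (3,3); (4,1); (2,2); (3,4);
     (5,3); (4,5); (5,7); (3,6); (5,5); (4,3); (2,4); (1,2)]);
  vm_compute; reflexivity.
Qed.

Lemma rect_tour_6_10 : rect_tour 6 10.
Proof.
  apply (rect_tour_base 6 10
    [(0,0); (1,2); (0,4); (1,6); (0,8); (2,9); (4,8); (5,6); (3,7); (4,9);
     (5,7); (4,5); (5,3); (4,1); (2,0); (0,1); (1,3); (0,5); (1,7); (0,9);
     (2,8); (0,7); (1,9); (3,8); (5,9); (4,7); (5,5); (3,6); (2,4); (0,3);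
     (1,1); (3,0); (5,1); (3,2); (4,0); (5,2); (4,4); (2,5); (3,3); (5,4);
     (4,6); (5,8); (3,9); (1,8); (0,6); (2,7); (1,5); (3,4); (2,6); (1,4);
     (2,2); (1,0); (0,2); (2,3); (3,5); (4,3); (3,1); (5,0); (4,2); (2,1)]);
  vm_compute; reflexivity.
Qed.

Lemma rect_tour_7_6 : rect_tour 7 6.
Proof.
  apply (rect_tour_base 7 6
    [(0,0); (2,1); (0,2); (1,0); (3,1); (5,0); (6,2); (5,4); (3,5); (1,4);
     (3,3); (2,5); (0,4); (2,3); (1,5); (0,3); (1,1); (3,0); (5,1); (6,3);
     (4,2); (6,1); (4,0); (5,2); (6,0); (4,1); (2,2); (0,1); (2,0); (3,2);
     (4,4); (6,5); (5,3); (4,5); (6,4); (4,3); (5,5); (3,4); (1,3); (0,5);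
     (2,4); (1,2)]);
  vm_compute; reflexivity.
Qed.

Lemma rect_tour_7_8 : rect_tour 7 8.
Proof.
  apply (rect_tour_base 7 8
    [(0,0); (2,1); (4,0); (6,1); (5,3); (6,5); (5,7); (3,6); (1,7); (0,5);
     (1,3); (0,1); (2,0); (3,2); (5,1); (6,3); (4,4); (5,6); (3,7); (1,6);
     (0,4); (2,5); (0,6); (2,7); (4,6); (6,7); (5,5); (4,7); (6,6); (5,4);
     (3,5); (2,3); (0,2); (1,0); (3,1); (5,0); (4,2); (3,0); (1,1); (0,3);
     (1,5); (0,7); (2,6); (3,4); (2,2); (1,4); (3,3); (4,5); (6,4); (5,2);
     (6,0); (4,1); (6,2); (4,3); (2,4); (1,2)]);
  vm_compute; reflexivity.
Qed.

Lemma rect_tour_7_10 : rect_tour 7 10.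
Proof.
  apply (rect_tour_base 7 10
    [(0,0); (2,1); (4,0); (6,1); (5,3); (6,5); (5,7); (6,9); (4,8); (6,7);
     (5,9); (3,8); (1,9); (0,7); (2,8); (0,9); (1,7); (2,9); (0,8); (1,6);
     (0,4); (2,5); (0,6); (1,8); (3,9); (2,7); (4,6); (5,8); (6,6); (5,4);
     (6,2); (5,0); (4,2); (6,3); (5,1); (3,0); (1,1); (0,3); (1,5); (3,6);
     (5,5); (4,7); (6,8); (4,9); (3,7); (5,6); (3,5); (2,3); (4,4); (3,2);
     (2,0); (0,1); (1,3); (0,5); (2,6); (3,4); (2,2); (4,1); (6,0); (5,2);
     (6,4); (4,3); (3,1); (1,0); (0,2); (1,4); (3,3); (4,5); (2,4); (1,2)]);
  vm_compute; reflexivity.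
Qed.

Lemma rect_tour_8_8 : rect_tour 8 8.
Proof.
  apply (rect_tour_base 8 8
    [(0,0); (1,2); (0,4); (1,6); (3,7); (5,6); (7,7); (6,5); (7,3); (6,1);
     (4,0); (3,2); (2,0); (0,1); (1,3); (0,5); (1,7); (2,5); (0,6); (2,7);
     (4,6); (6,7); (7,5); (5,4); (6,6); (4,7); (3,5); (1,4); (2,6); (0,7);
     (1,5); (0,3); (1,1); (3,0); (5,1); (7,0); (6,2); (7,4); (5,3); (7,2);
     (6,0); (4,1); (2,2); (3,4); (5,5); (7,6); (5,7); (3,6); (2,4); (4,5);
     (3,3); (5,2); (6,4); (4,3); (3,1); (1,0); (0,2); (2,3); (4,4); (6,3);
     (7,1); (5,0); (4,2); (2,1)]);
  vm_compute; reflexivity.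
Qed.

Lemma rect_tour_8_10 : rect_tour 8 10.
Proof.
  apply (rect_tour_base 8 10
    [(0,0); (2,1); (4,0); (6,1); (7,3); (6,5); (7,7); (6,9); (4,8); (2,9);
     (0,8); (1,6); (0,4); (2,3); (0,2); (1,0); (3,1); (5,0); (7,1); (5,2);
     (6,0); (7,2); (6,4); (7,6); (6,8); (4,9); (2,8); (0,9); (1,7); (0,5);
     (1,3); (0,1); (2,0); (3,2); (4,4); (5,6); (7,5); (6,3); (5,1); (7,0);
     (6,2); (7,4); (5,3); (4,1); (3,3); (2,5); (0,6); (1,4); (2,2); (3,0);
     (1,1); (0,3); (1,5); (0,7); (1,9); (2,7); (3,9); (1,8); (3,7); (5,8);
     (7,9); (6,7); (5,9); (7,8); (6,6); (4,5); (5,7); (3,6); (5,5); (4,7);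
     (2,6); (3,8); (4,6); (3,4); (4,2); (5,4); (3,5); (4,3); (2,4); (1,2)]);
  vm_compute; reflexivity.
Qed.

Lemma rect_tour_9_6 : rect_tour 9 6.
Proof.
  apply (rect_tour_base 9 6
    [(0,0); (2,1); (0,2); (1,0); (3,1); (5,0); (7,1); (8,3); (7,5); (5,4);
     (3,5); (1,4); (3,3); (2,5); (0,4); (2,3); (1,5); (0,3); (1,1); (3,0);
     (4,2); (3,4); (5,5); (7,4); (8,2); (7,0); (6,2); (8,1); (6,0); (4,1);
     (2,2); (0,1); (1,3); (0,5); (2,4); (4,5); (5,3); (6,1); (8,0); (7,2);
     (8,4); (6,3); (5,1); (4,3); (6,4); (8,5); (7,3); (6,5); (4,4); (5,2);
     (4,0); (3,2); (2,0); (1,2)]);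
  vm_compute; reflexivity.
Qed.

Lemma rect_tour_9_8 : rect_tour 9 8.
Proof.
  apply (rect_tour_base 9 8
    [(0,0); (1,2); (2,0); (0,1); (1,3); (0,5); (1,7); (3,6); (5,7); (7,6);
     (8,4); (7,2); (8,0); (6,1); (4,0); (3,2); (2,4); (1,6); (0,4); (2,5);
     (0,6); (2,7); (4,6); (6,7); (8,6); (6,5); (7,7); (8,5); (7,3); (8,1);
     (6,0); (4,1); (5,3); (7,4); (8,2); (7,0); (5,1); (3,0); (1,1); (0,3);
     (1,5); (0,7); (2,6); (3,4); (5,5); (4,7); (6,6); (8,7); (7,5); (6,3);
     (7,1); (8,3); (6,2); (5,0); (4,2); (5,4); (3,5); (1,4); (2,2); (1,0);
     (0,2); (2,3); (3,1); (4,3); (6,4); (4,5); (3,7); (5,6); (4,4); (5,2);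
     (3,3); (2,1)]);
  vm_compute; reflexivity.
Qed.

Lemma rect_tour_9_10 : rect_tour 9 10.
Proof.
  apply (rect_tour_base 9 10
    [(0,0); (2,1); (4,0); (6,1); (8,0); (7,2); (6,0); (8,1); (7,3); (8,5);
     (7,7); (8,9); (6,8); (4,9); (2,8); (0,9); (1,7); (0,5); (1,3); (0,1);
     (2,0); (3,2); (5,1); (7,0); (8,2); (7,4); (8,6); (7,8); (5,9); (3,8);
     (1,9); (0,7); (1,5); (0,3); (1,1); (3,0); (2,2); (1,0); (0,2); (1,4);
     (0,6); (1,8); (2,6); (4,7); (3,9); (5,8); (7,9); (8,7); (6,6); (5,4);
     (7,5); (8,3); (7,1); (5,0); (6,2); (4,1); (5,3); (3,4); (4,2); (6,3);
     (8,4); (6,5); (4,6); (6,7); (8,8); (6,9); (5,7); (7,6); (5,5); (3,6);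
     (4,8); (2,7); (0,8); (2,9); (3,7); (1,6); (3,5); (5,6); (4,4); (2,3);
     (0,4); (2,5); (3,3); (4,5); (2,4); (4,3); (6,4); (5,2); (3,1); (1,2)]);
  vm_compute; reflexivity.
Qed.

Lemma rect_tour_base_row m n :
  5 <= m <= 9 -> n = 6 \/ n = 8 \/ n = 10 -> rect_tour m n.
Proof.
  intros hm hn.
  assert (Hm : m = 5 \/ m = 6 \/ m = 7 \/ m = 8 \/ m = 9) by lia.
  destruct hn as [-> | [-> | ->]]; destruct Hm as [-> | [-> | [-> | [-> | ->]]]];
    first [exact rect_tour_5_6 | exact rect_tour_5_8 | exact rect_tour_5_10
          |exact rect_tour_6_6 | exact rect_tour_6_8 | exact rect_tour_6_10
          |exact rect_tour_7_6 | exact rect_tour_7_8 | exact rect_tour_7_10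
          |exact (rect_tour_transpose _ _ rect_tour_6_8) | exact rect_tour_8_8
          |exact rect_tour_8_10 | exact rect_tour_9_6 | exact rect_tour_9_8
          |exact rect_tour_9_10].
Qed.

Lemma rect_tour_row m n :
  5 <= m -> n = 6 \/ n = 8 \/ n = 10 -> rect_tour m n.
Proof.
  intros hm hn.
  assert (R : forall j : nat, forall i, 5 <= i <= 9 -> rect_tour (i + 5 * Z.of_nat j) n).
  { induction j as [|j IH]; intros i Hi.
    - replace (i + 5 * Z.of_nat 0) with i by lia; apply rect_tour_base_row; assumption.
    - rewrite Nat2Z.inj_succ, Z.mul_succ_r, Z.add_assoc.
      apply rect_tour_glue; [lia.. | apply IH; exact Hi |].
      apply rect_tour_base_row; lia. }
  pose proof (Z.div_mod m 5); pose proof (Z.mod_pos_bound m 5).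
  (* Widths 5 to 9 represent all residues modulo 5, and every further piece has width 5. *)
  specialize (R (Z.to_nat (m / 5 - 1)) (m mod 5 + 5)).
  replace (m mod 5 + 5 + 5 * Z.of_nat (Z.to_nat (m / 5 - 1))) with m in R by lia.
  apply R; lia.
Qed.

Lemma rect_tour_even m n :
  5 <= m -> 5 <= n -> Z.even n = true -> rect_tour m n.
Proof.
  intros hm hn ev; apply Z.even_spec in ev as [i ->].
  assert (R : forall j : nat, forall r, r = 6 \/ r = 8 \/ r = 10 ->
            rect_tour (r + 6 * Z.of_nat j) m).
  { induction j as [|j IH]; intros r Hr.
    - replace (r + 6 * Z.of_nat 0) with r by lia.
      apply rect_tour_transpose, rect_tour_row; assumption.
    - rewrite Nat2Z.inj_succ, Z.mul_succ_r, Z.add_assoc.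
      apply rect_tour_glue; [lia.. | apply IH; exact Hr |].
      apply rect_tour_transpose, rect_tour_row; [exact hm | lia]. }
  apply rect_tour_transpose.
  pose proof (Z.div_mod i 3); pose proof (Z.mod_pos_bound i 3).
  (* Likewise 6, 8 and 10 represent the even residues modulo 6, and further pieces have height 6. *)
  specialize (R (Z.to_nat (i / 3 - 1)) (2 * (i mod 3) + 6)).
  replace (2 * (i mod 3) + 6 + 6 * Z.of_nat (Z.to_nat (i / 3 - 1)))
    with (2 * i) in R by lia.
  apply R; lia.
Qed.

Lemma nullhomotopic_tour_large m n :
  5 <= m -> 5 <= n -> Z.odd m && Z.odd n = false -> has_nullhomotopic_tour m n.
Proof.
  intros hm hn O.
  assert (R : rect_tour m n).
  { rewrite <- !Z.negb_even in O.
    destruct (Z.even n) eqn:En; [apply rect_tour_even; assumption|].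
    apply rect_tour_transpose, rect_tour_even; [assumption.. |].
    destruct (Z.even m); [reflexivity | discriminate O]. }
  destruct R as (l & C & E & _).
  apply (cycle_nullhomotopic_tour m n l); [lia | lia | exact C |].
  apply transversal_rect; [lia | exact E].
Qed.

(** * Existence for all admissible sizes *)

Lemma strip_tour_residues m n :
  (forall m, 0 < m -> strip_tour m n -> strip_tour (m + 6) n) ->
  forall r, 0 < r <= m -> (m - r) mod 6 = 0 -> strip_tour r n -> strip_tour m n.
Proof.
  intros St r hr hm St0.
  assert (R : forall j : nat, strip_tour (r + 6 * Z.of_nat j) n).
  { induction j as [|j IH]; [replace (r + 6 * Z.of_nat 0) with r by lia; exact St0|].
    rewrite Nat2Z.inj_succ, Z.mul_succ_r, Z.add_assoc; apply St; [lia | exact IH]. }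
  pose proof (Z.div_mod (m - r) 6) as D.
  specialize (R (Z.to_nat ((m - r) / 6))).
  replace (r + 6 * Z.of_nat (Z.to_nat ((m - r) / 6))) with m in R by lia; exact R.
Qed.

(** The starting widths are the least admissible ones in their classes modulo 6. For [n = 1] and
    [n = 3] odd widths fail by parity and width 4 is excluded, so the class of 4 starts at 10; for
    [n = 4] width 3 is excluded and its class starts at 9. *)
Lemma strip_tour_short m n :
  n = 1 /\ 6 <= m /\ Z.even m = true \/ n = 2 /\ 3 <= m \/
  n = 3 /\ 6 <= m /\ Z.even m = true \/ n = 4 /\ 4 <= m ->
  strip_tour m n.
Proof.
  assert (E : Z.even m = true -> m mod 2 = 0)
    by (rewrite Zmod_even; intros ->; reflexivity).
  intros [(-> & hm & ev) | [(-> & hm) | [(-> & hm & ev) | (-> & hm)]]].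
  - pose proof (E ev) as m2.
    assert (H : (m - 6) mod 6 = 0 \/ (m - 8) mod 6 = 0 /\ 8 <= m \/
                (m - 10) mod 6 = 0 /\ 10 <= m) by (Z.to_euclidean_division_equations; lia).
    pose proof (strip_tour_residues m 1 strip_tour_step1) as R.
    destruct H as [H | [[H H'] | [H H']]].
    + apply (R 6); [lia | exact H | exact strip_tour_6_1].
    + apply (R 8); [lia | exact H | exact strip_tour_8_1].
    + apply (R 10); [lia | exact H | exact strip_tour_10_1].
  - assert (H : (m - 3) mod 6 = 0 \/ (m - 4) mod 6 = 0 /\ 4 <= m \/
                (m - 5) mod 6 = 0 /\ 5 <= m \/ (m - 6) mod 6 = 0 /\ 6 <= m \/
                (m - 7) mod 6 = 0 /\ 7 <= m \/ (m - 8) mod 6 = 0 /\ 8 <= m)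
      by (Z.to_euclidean_division_equations; lia).
    pose proof (strip_tour_residues m 2 strip_tour_step2) as R.
    destruct H as [H | [[H H'] | [[H H'] | [[H H'] | [[H H'] | [H H']]]]]].
    + apply (R 3); [lia | exact H | exact strip_tour_3_2].
    + apply (R 4); [lia | exact H | exact strip_tour_4_2].
    + apply (R 5); [lia | exact H | exact strip_tour_5_2].
    + apply (R 6); [lia | exact H | exact strip_tour_6_2].
    + apply (R 7); [lia | exact H | exact strip_tour_7_2].
    + apply (R 8); [lia | exact H | exact strip_tour_8_2].
  - pose proof (E ev) as m2.
    assert (H : (m - 6) mod 6 = 0 \/ (m - 8) mod 6 = 0 /\ 8 <= m \/
                (m - 10) mod 6 = 0 /\ 10 <= m) by (Z.to_euclidean_division_equations; lia).
    pose proof (strip_tour_residues m 3 strip_tour_step3) as R.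
    destruct H as [H | [[H H'] | [H H']]].
    + apply (R 6); [lia | exact H | exact strip_tour_6_3].
    + apply (R 8); [lia | exact H | exact strip_tour_8_3].
    + apply (R 10); [lia | exact H | exact strip_tour_10_3].
  - assert (H : (m - 4) mod 6 = 0 \/ (m - 5) mod 6 = 0 /\ 5 <= m \/
                (m - 6) mod 6 = 0 /\ 6 <= m \/ (m - 7) mod 6 = 0 /\ 7 <= m \/
                (m - 8) mod 6 = 0 /\ 8 <= m \/ (m - 9) mod 6 = 0 /\ 9 <= m)
      by (Z.to_euclidean_division_equations; lia).
    pose proof (strip_tour_residues m 4 strip_tour_step4) as R.
    destruct H as [H | [[H H'] | [[H H'] | [[H H'] | [[H H'] | [H H']]]]]].
    + apply (R 4); [lia | exact H | exact strip_tour_4_4].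
    + apply (R 5); [lia | exact H | exact strip_tour_5_4].
    + apply (R 6); [lia | exact H | exact strip_tour_6_4].
    + apply (R 7); [lia | exact H | exact strip_tour_7_4].
    + apply (R 8); [lia | exact H | exact strip_tour_8_4].
    + apply (R 9); [lia | exact H | exact strip_tour_9_4].
Qed.

Lemma nullhomotopic_tour_exists m n :
  3 <= m -> 0 < n -> Z.odd m && Z.odd n = false -> ~ (m = 3 /\ n = 4) ->
  ~ (m = 4 /\ Z.odd n = true) -> has_nullhomotopic_tour m n.
Proof.
  intros hm hn O H3 H4.
  assert (Ev : forall x, Z.odd x = false -> Z.even x = true)
    by (intros x H; rewrite <- Z.negb_odd, H; reflexivity).
  assert (Ev' : forall x, Z.odd x = false -> exists j, x = 2 * j)
    by (intros x H; apply Z.even_spec, Ev, H).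
  destruct (Z_lt_dec n 5) as [Hn | Hn].
  - destruct (strip_tour_short m n) as (l & C & T & _).
    + assert (D : n = 1 \/ n = 2 \/ n = 3 \/ n = 4) by lia.
      destruct D as [-> | [-> | [-> | ->]]]; [| lia | | lia].
      * rewrite andb_true_r in O; destruct (Ev' m O) as [j ->].
        left; repeat split; [|apply Ev, O].
        assert (2 * j <> 4) by (intros E; apply H4; auto); lia.
      * rewrite andb_true_r in O; destruct (Ev' m O) as [j ->].
        right; right; left; repeat split; [|apply Ev, O].
        assert (2 * j <> 4) by (intros E; apply H4; auto); lia.
    + exact (cycle_nullhomotopic_tour m n l hn hm C T).
  - assert (D : m = 3 \/ m = 4 \/ 5 <= m) by lia.
    destruct D as [-> | [-> | D]].
    + simpl in O; destruct (Ev' n O) as [j Ej].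
      destruct (Z.eq_dec n 6) as [-> |]; [exact nullhomotopic_tour_3_6|].
      destruct (Z.eq_dec n 8) as [-> |]; [exact nullhomotopic_tour_3_8|].
      apply nullhomotopic_tour_3; [lia | apply Ev, O].
    + apply nullhomotopic_tour_4; [lia|].
      apply Ev; destruct (Z.odd n); [destruct H4; auto | reflexivity].
    + apply nullhomotopic_tour_large; [lia.. | exact O].
Qed.

(** * Obstructions *)

(** The lift as a function of the position, suited to induction along the walk. [ct_two] holds
    because a tour of two steps starting and ending at [(0, 0)] in the strip would use one edge
    twice. *)
Record closed_tour (m n : Z) (f : nat -> cell) (k : nat) : Prop := {
  ct_pos : (0 < k)%nat;
  ct_start : f 0%nat = (0, 0);
  ct_end : f k = (0, 0);
  ct_adj : forall i, (i < k)%nat -> S_adj m (f i) (f (S i));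
  ct_two : k <> 2%nat;
  ct_enum : enumerates (rect m n) (map (fun i => normal_form m n (f i)) (seq 0 k)) }.

Lemma nullhomotopic_closed_tour m n :
  0 < m -> 0 < n -> has_nullhomotopic_tour m n ->
  (m = 1 /\ n = 1) \/ exists f k, closed_tour m n f k.
Proof.
  intros hm hn (w & ((Wn & Wa) & W0 & _ & D & De & V) & E).
  set (f := fun i => nth i w (0, 0)); set (k := (length w - 1)%nat).
  assert (Lw : length w = S k).
  { destruct w; [destruct Wn; reflexivity|]; unfold k; simpl; lia. }
  assert (Fk : f k = (0, 0)).
  { destruct (exists_last Wn) as (t & x & Et); unfold f, k.
    rewrite Et, last_last in E; subst x.
    rewrite Et, length_app, Nat.add_sub, nth_middle; reflexivity. }
  assert (S0 : forall a b, 0 <= a < m -> 0 <= b < n ->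
            exists i, (i <= k)%nat /\ normal_form m n (f i) = (a, b)).
  { intros a b Ha Hb; destruct (V a b Ha Hb) as (i & Hi & O).
    exists i; split; [lia|]; apply same_orbit_normal_form in O; [|exact hn].
    rewrite normal_form_id in O by lia; exact O. }
  assert (Fs : forall i, (i < k)%nat -> in_strip m (f i))
    by (intros i Hi; apply (Wa i); lia).
  destruct (Nat.eq_dec k 0) as [Ek | Ek]; [left | right; exists f, k].
  - rewrite Ek in S0.
    (* A trivial walk must also visit the opposite corner, which leaves only the 1 by 1 board. *)
    destruct (S0 (m - 1) (n - 1)) as (i & Hi & F); [lia..|].
    replace (f i) with ((0, 0) : cell) in F
      by (replace i with 0%nat by lia; symmetry; exact W0).
    rewrite normal_form_id in F by lia; injection F; lia.
  - split; auto; [lia | intros i Hi; apply Wa; lia | |].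
    + intros E2; apply (De 0%nat 1%nat); [lia..|].
      exists 0; right; split; [|reflexivity].
      change (f 0%nat = f 2%nat); rewrite <- E2, Fk; exact W0.
    + split.
      * apply NoDup_map_NoDup_ForallPairs; [|apply seq_NoDup].
        intros i j Hi Hj F; apply in_seq in Hi, Hj.
        apply same_orbit_normal_form in F; [|exact hn].
        destruct (Nat.lt_trichotomy i j) as [H | [H | H]]; [|exact H|].
        -- destruct (D i j H); [lia | exact F].
        -- destruct (D j i H); [lia|].
           apply same_orbit_normal_form; [exact hn|]; symmetry.
           apply same_orbit_normal_form; [exact hn | exact F].
      * intros x; rewrite in_map_iff, in_rect; split.
        -- intros (i & <- & Hi); apply in_seq in Hi.
           apply normal_form_box; [exact hn | apply Fs; lia].
        -- destruct x as [a b]; intros [Ha Hb].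
           destruct (S0 a b Ha Hb) as (i & Hi & F).
           destruct (Nat.eq_dec i k) as [-> | Hk].
           ++ exists 0%nat; rewrite in_seq; split; [|lia].
              rewrite <- F, Fk; f_equal; exact W0.
           ++ exists i; rewrite in_seq; split; [exact F | lia].
Qed.

Lemma closed_tour_perm m n f k :
  closed_tour m n f k ->
  Permutation (map (fun i => normal_form m n (f i)) (seq 0 k)) (rect m n).
Proof.
  intros T; destruct (ct_enum _ _ _ _ T) as [N H].
  apply NoDup_Permutation; [exact N | apply NoDup_rect | exact H].
Qed.

Lemma closed_tour_length m n f k :
  0 < m -> 0 < n -> closed_tour m n f k -> Z.of_nat k = m * n.
Proof.
  intros hm hn T; pose proof (Permutation_length (closed_tour_perm _ _ _ _ T)) as L.
  unfold rect, zrange, cell in L.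
  rewrite length_map, length_seq, length_prod, !length_map, !length_seq in L; nia.
Qed.

Lemma closed_tour_inj m n f k i j :
  closed_tour m n f k -> (i < k)%nat -> (j < k)%nat ->
  normal_form m n (f i) = normal_form m n (f j) -> i = j.
Proof.
  intros T Hi Hj; destruct (ct_enum _ _ _ _ T) as [N _].
  apply (NoDup_map_inj _ _ _ _ N); apply in_seq; lia.
Qed.

Lemma closed_tour_strip m n f k i :
  0 < m -> closed_tour m n f k -> (i <= k)%nat -> in_strip m (f i).
Proof.
  intros hm T Hi; destruct (Nat.eq_dec i k) as [-> | H].
  - rewrite (ct_end _ _ _ _ T); unfold in_strip; simpl; lia.
  - apply (ct_adj _ _ _ _ T i); lia.
Qed.

Definition white (p : cell) : bool := Z.even (fst p + snd p).

Lemma knight_move_white p q : knight_move p q -> white q = negb (white p).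
Proof.
  unfold knight_move, white; intros H.
  assert (E : exists j, fst q + snd q = fst p + snd p + 1 + 2 * j).
  { set (d := fst q + snd q - (fst p + snd p)).
    assert (D : d = -3 \/ d = -1 \/ d = 1 \/ d = 3) by lia.
    destruct D as [D | [D | [D | D]]];
      [exists (-2) | exists (-1) | exists 0 | exists 1]; lia. }
  destruct E as [j ->]; rewrite !Z.even_add, Z.even_mul; cbn [Z.even orb].
  destruct (Bool.eqb (Z.even (fst p)) (Z.even (snd p))); reflexivity.
Qed.

Lemma closed_tour_white m n f k i :
  closed_tour m n f k -> (i <= k)%nat -> white (f i) = Nat.even i.
Proof.
  intros T; induction i as [|i IH]; intros Hi.
  - rewrite (ct_start _ _ _ _ T); reflexivity.
  - rewrite (knight_move_white (f i)) by (apply (ct_adj _ _ _ _ T); lia).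
    rewrite IH, Nat.even_succ, <- Nat.negb_even by lia; reflexivity.
Qed.

(** The chessboard colouring is used on the strip, where knight moves always change colour. A lift
    that closes up therefore has an even number of steps, but this number is [m * n]. *)
Lemma no_closed_tour_odd m n f k :
  0 < m -> 0 < n -> Z.odd m = true -> Z.odd n = true -> ~ closed_tour m n f k.
Proof.
  intros hm hn om on T.
  pose proof (closed_tour_white _ _ _ _ k T (le_n k)) as W.
  rewrite (ct_end _ _ _ _ T) in W; change (true = Nat.even k) in W.
  symmetry in W; apply Nat.even_spec in W as [j ->].
  pose proof (closed_tour_length _ _ _ _ hm hn T) as L.
  apply (f_equal Z.odd) in L; rewrite Z.odd_mul, om, on in L.
  rewrite Nat2Z.inj_mul, Z.odd_mul in L; discriminate L.
Qed.

Lemma no_closed_tour_1 n f k : ~ closed_tour 1 n f k.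
Proof.
  intros T; destruct (ct_adj _ _ _ _ T 0 (ct_pos _ _ _ _ T)) as (H1 & H2 & K).
  unfold in_strip, knight_move in *; lia.
Qed.

(** The strip of width 2 is a disjoint union of paths along which [b] is monotone. *)
Lemma no_closed_tour_2 n f k : ~ closed_tour 2 n f k.
Proof.
  intros T; pose proof (ct_pos _ _ _ _ T) as K0.
  (* The walk never turns back: that would repeat a vertex, or, at the very end, force [k = 2]. *)
  assert (B : forall i, (S (S i) <= k)%nat -> f (S (S i)) <> f i).
  { intros i Hi E; destruct (Nat.eq_dec (S (S i)) k) as [Ek | Ek].
    - assert (i = 0%nat).
      { apply (closed_tour_inj _ _ _ _ _ _ T); [lia..|].
        rewrite <- E, Ek, (ct_end _ _ _ _ T), (ct_start _ _ _ _ T); reflexivity. }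
      apply (ct_two _ _ _ _ T); lia.
    - enough (S (S i) = i) by lia.
      apply (closed_tour_inj _ _ _ _ _ _ T); [lia.. | rewrite E; reflexivity]. }
  assert (A : forall i, (i < k)%nat ->
            0 <= fst (f i) < 2 /\ 0 <= fst (f (S i)) < 2 /\
            Z.abs (fst (f i) - fst (f (S i))) = 1 /\
            Z.abs (snd (f i) - snd (f (S i))) = 2).
  { intros i Hi; destruct (ct_adj _ _ _ _ T i Hi) as (H1 & H2 & [H | H]);
      unfold in_strip in *; [tauto | lia]. }
  (* In width 2 the coordinate [a] alternates and [b] changes by 2 in absolute value; a change of
     direction would return to the cell before last. *)
  assert (M : forall i, (i < k)%nat -> snd (f (S i)) - snd (f i) = snd (f 1%nat)).
  { induction i as [|i IH]; intros Hi.
    - rewrite (ct_start _ _ _ _ T); simpl; lia.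
    - rewrite <- IH by lia; pose proof (A i ltac:(lia)); pose proof (A (S i) Hi).
      destruct (Z.eq_dec (snd (f (S (S i)))) (snd (f i))) as [E | E]; [|lia].
      destruct (B i Hi); apply injective_projections; lia. }
  assert (N : forall i, (i <= k)%nat -> snd (f i) = Z.of_nat i * snd (f 1%nat)).
  { induction i as [|i IH]; intros Hi.
    - rewrite (ct_start _ _ _ _ T); reflexivity.
    - pose proof (M i Hi); rewrite Nat2Z.inj_succ, Z.mul_succ_l, <- IH; lia. }
  pose proof (N k (le_n k)) as F; rewrite (ct_end _ _ _ _ T) in F.
  pose proof (A 0%nat K0) as H; rewrite (ct_start _ _ _ _ T) in H.
  cbn [fst snd] in F, H; nia.
Qed.

(** A conditional, since [vm_compute] would evaluate both arguments of [&&]. *)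
Fixpoint extends (m n : Z) (fuel : nat) (seen : list cell) (p : cell) : bool :=
  match fuel with
  | O => knightb p (0, 0)
  | S fuel =>
      existsb (fun d =>
        let q := (fst p + fst d, snd p + snd d) in
        let x := normal_form m n q in
        if knightb p q && stripb m q && negb (existsb (cell_eqb x) seen)
        then extends m n fuel (x :: seen) q else false)
        (list_prod [-2; -1; 1; 2] [-2; -1; 1; 2])
  end.

(** The tour itself is a branch on which the search succeeds. The last step is the closing one,
    tested when the fuel is used up; hence fuel 11 for the 12 cells of the 3 by 4 board. *)
Lemma closed_tour_extends m n f k fuel i seen :
  closed_tour m n f k -> (i + S fuel)%nat = k ->
  (forall x, In x seen -> exists j, (j <= i)%nat /\ x = normal_form m n (f j)) ->
  extends m n fuel seen (f i) = true.
Proof.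
  intros T; revert i seen; induction fuel as [|fuel IH]; intros i seen Hi Sn.
  - cbn [extends]; apply knightb_move; rewrite <- (ct_end _ _ _ _ T), <- Hi.
    rewrite Nat.add_1_r; apply (ct_adj _ _ _ _ T); lia.
  - destruct (ct_adj _ _ _ _ T i) as (_ & St & Kn); [lia|].
    cbn [extends]; apply existsb_exists.
    exists (fst (f (S i)) - fst (f i), snd (f (S i)) - snd (f i)); split.
    { unfold knight_move in Kn; apply in_prod_iff; simpl; lia. }
    cbn [fst snd]; rewrite !Zplus_minus, <- !surjective_pairing.
    rewrite <- andb_lazy_alt, !andb_true_iff, negb_true_iff.
    split; [split; [split|]|].
    + apply knightb_move; exact Kn.
    + unfold stripb; unfold in_strip in St; lia.
    + apply not_true_iff_false; intros H; apply existsb_exists in H as (x & Hx & E).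
      apply cell_eqb_eq in E; destruct (Sn x Hx) as (j & Hj & ->).
      apply (closed_tour_inj _ _ _ _ _ _ T) in E; lia.
    + apply IH; [lia|]; intros x [<- | Hx]; [exists (S i); auto|].
      destruct (Sn x Hx) as (j & Hj & E); exists j; auto.
Qed.

Lemma no_closed_tour_3_4 f k : ~ closed_tour 3 4 f k.
Proof.
  intros T; pose proof (closed_tour_length 3 4 f k eq_refl eq_refl T) as L.
  assert (E : extends 3 4 11 [(0, 0)] (0, 0) = true).
  { pose proof (closed_tour_extends 3 4 f k 11 0 [(0, 0)] T) as H.
    rewrite (ct_start _ _ _ _ T) in H; apply H; [lia|].
    intros x [<- | []]; exists 0%nat; rewrite (ct_start _ _ _ _ T); auto. }
  vm_compute in E; discriminate E.
Qed.

(** With signs, border cells being half of all cells is a vanishing sum, and two of them never being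
    adjacent is a nonpositive sum along each edge. *)
Definition border_sign (p : cell) : Z :=
  if (fst p =? 0) || (fst p =? 3) then 1 else -1.

Definition zsum (l : list Z) : Z := fold_right Z.add 0 l.

Lemma zsum_app l l' : zsum (l ++ l') = zsum l + zsum l'.
Proof. induction l as [|x l IH]; simpl; lia. Qed.

Lemma zsum_perm l l' : Permutation l l' -> zsum l = zsum l'.
Proof. induction 1; simpl in *; lia. Qed.

Lemma zsum_border_rect n : zsum (map border_sign (rect 4 n)) = 0.
Proof.
  assert (H : forall a l, zsum (map border_sign (map (fun b => (a, b)) l)) =
                          border_sign (a, 0) * Z.of_nat (length l)).
  { intros a l; induction l as [|b l IH]; [simpl; lia|].
    cbn [map zsum fold_right length]; rewrite Nat2Z.inj_succ, Z.mul_succ_r.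
    unfold zsum in IH; rewrite IH.
    change (border_sign (a, b)) with (border_sign (a, 0)); lia. }
  unfold rect; change (zrange 4) with [0; 1; 2; 3]; cbn [list_prod].
  rewrite app_nil_r, !map_app, !zsum_app, !H.
  change (border_sign (0, 0)) with 1; change (border_sign (1, 0)) with (-1).
  change (border_sign (2, 0)) with (-1); change (border_sign (3, 0)) with 1; lia.
Qed.

(** In the strip of width 4, two border cells are never adjacent. As half of the cells
    are border cells, they alternate with inner cells along the tour, hence they all have
    the same colour; but for odd [n] the colour is constant on orbits. *)
Lemma no_closed_tour_4_odd n f k :
  0 < n -> Z.odd n = true -> ~ closed_tour 4 n f k.
Proof.
  intros hn on T.
  pose proof (fun i => closed_tour_strip 4 n f k i eq_refl T) as St.
  set (s := fun i => border_sign (f i)).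
  assert (Le : forall i, (i < k)%nat -> s i + s (S i) <= 0).
  { intros i Hi; destruct (ct_adj _ _ _ _ T i Hi) as (H1 & H2 & K).
    unfold s, border_sign, in_strip, knight_move in *.
    destruct (Z.eqb_spec (fst (f i)) 0), (Z.eqb_spec (fst (f i)) 3),
      (Z.eqb_spec (fst (f (S i))) 0), (Z.eqb_spec (fst (f (S i))) 3); simpl; lia. }
  assert (Z0 : zsum (map s (seq 0 k)) = 0).
  { rewrite <- (zsum_border_rect n).
    rewrite <- (zsum_perm _ _ (Permutation_map _ (closed_tour_perm _ _ _ _ T))).
    rewrite map_map; f_equal; apply map_ext_in; intros i Hi; apply in_seq in Hi.
    pose proof (St i ltac:(lia)) as Si; unfold in_strip in Si.
    unfold s, border_sign, normal_form; cbn [fst].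
    destruct (Z.even (snd (f i) / n)); [reflexivity|].
    destruct (Z.eqb_spec (fst (f i)) 0), (Z.eqb_spec (fst (f i)) 3),
      (Z.eqb_spec (4 - 1 - fst (f i)) 0), (Z.eqb_spec (4 - 1 - fst (f i)) 3);
      simpl; lia. }
  (* Summing the inequalities [Le] over [i < j] telescopes to this bound, and equality forces
     equality in each of them. At [j = k] both sides are 0. *)
  assert (Tele : forall j, (j <= k)%nat ->
            2 * zsum (map s (seq 0 j)) <= s 0%nat - s j /\
            (2 * zsum (map s (seq 0 j)) = s 0%nat - s j ->
             forall i, (i < j)%nat -> s i + s (S i) = 0)).
  { induction j as [|j IH]; intros Hj; [simpl; split; [|intros _ i Hi]; lia|].
    destruct IH as [IH1 IH2]; [lia|]; pose proof (Le j Hj).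
    rewrite seq_S, map_app, zsum_app; cbn [map zsum fold_right Nat.add].
    split; [lia|]; intros E i Hi.
    destruct (Nat.eq_dec i j) as [-> | Hij]; [lia|].
    apply IH2; lia. }
  destruct (Tele k (le_n k)) as [_ Alt].
  assert (Sk : s k = s 0%nat)
    by (unfold s; rewrite (ct_end _ _ _ _ T), (ct_start _ _ _ _ T); reflexivity).
  rewrite Z0, Sk, Z.sub_diag in Alt; specialize (Alt eq_refl).
  assert (C : forall i, (i <= k)%nat -> s i = if white (f i) then 1 else -1).
  { induction i as [|i IH]; intros Hi.
    - unfold s; rewrite (ct_start _ _ _ _ T); reflexivity.
    - pose proof (Alt i Hi); specialize (IH ltac:(lia)).
      rewrite (knight_move_white (f i)) by (apply (ct_adj _ _ _ _ T); lia).
      destruct (white (f i)); simpl in *; lia. }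
  (* For odd [n] the reflection [3 - a] and the translation by [n] both change the colour, so
     together they preserve it. *)
  assert (Inv : forall p, white (normal_form 4 n p) = white p).
  { intros [a b]; unfold white, normal_form; cbn [fst snd].
    rewrite (Z.div_mod b n) at 3 by lia.
    rewrite !Z.even_add, Z.even_mul, <- (Z.negb_odd n), on; cbn [negb orb].
    destruct (Z.even (b / n)).
    - destruct (Z.even a), (Z.even (b mod n)); reflexivity.
    - rewrite Z.even_sub.
      destruct (Z.even a), (Z.even (b mod n)); reflexivity. }
  destruct (ct_enum _ _ _ _ T) as [_ H].
  (* The border cell [(3, 0)] is black. The tour visits its orbit in a cell that is also black and
     on the border, while [C] makes every visited border cell white. *)
  assert (In (3, 0) (rect 4 n)) as H3 by (apply in_rect; simpl; lia).
  apply H, in_map_iff in H3 as (i & E & Hi); apply in_seq in Hi.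
  specialize (C i ltac:(lia)); rewrite <- Inv, E in C.
  change (white (3, 0)) with false in C.
  assert (E' : fst (f i) = 0 \/ fst (f i) = 3).
  { apply (f_equal fst) in E; unfold normal_form in E; cbn [fst] in E.
    destruct (Z.even (snd (f i) / n)); lia. }
  unfold s, border_sign in C.
  destruct E' as [E' | E']; rewrite E' in C; discriminate C.
Qed.

Theorem theorem4p1 (m n : Z) (hm : 0 < m) (hn : 0 < n) :
  has_nullhomotopic_tour m n <->
  ~ ( (Z.odd m = true /\ Z.odd n = true /\ (1 < m \/ 1 < n))
    \/ (m = 1 /\ 1 < n)
    \/ m = 2
    \/ (m = 3 /\ n = 4)
    \/ (m = 4 /\ Z.odd n = true) ).
Proof.
  split.
  - intros H; destruct (nullhomotopic_closed_tour m n hm hn H)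
      as [[-> ->] | (f & k & T)]; [lia|].
    clear H; intros [(om & on & _) | [(-> & _) | [-> | [(-> & ->) | (-> & on)]]]]; revert T.
    + apply no_closed_tour_odd; assumption.
    + apply no_closed_tour_1.
    + apply no_closed_tour_2.
    + apply no_closed_tour_3_4.
    + apply no_closed_tour_4_odd; assumption.
  - intros H; destruct (Z.eq_dec m 1) as [-> | H1].
    + assert (n = 1) as -> by lia; apply nullhomotopic_tour_1_1.
    + apply nullhomotopic_tour_exists; [lia | exact hn | | tauto | tauto].
      destruct (Z.odd m), (Z.odd n); simpl; try reflexivity.
      exfalso; apply H; left; repeat split; lia.
Qed.
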